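(* Let $A$ be a degenerate–resonant combinatorial graph. Then there is a vertex $g$ of $A$ such that the translated combinatorial graph $Ag^{-1}=\{hg^{-1}: h\in A\}$ is not allowable. Consequently, if $S=(\mathtt v_1,\dots,\mathtt v_m)\in(\mathbb R^n)^m$ satisfies $(\mathtt v_i,\mathtt v_j)\neq 0$ for all $i,j$ and $(\mathtt v_a-\mathtt v_b,\mathtt v_a-\mathtt v_c)\ne 0$ for all pairwise distinct $a,b,c$, then $A$ has no realization $x\in\mathbb R^n\setminus\{\mathtt v_1,\dots,\mathtt v_m\}$.
   Context: Let $e_1,\dots,e_m$ be the standard basis of $\mathbb Z^m$ and $\eta(a)=\sum_i a_i$ for $a=\sum_i a_ie_i$. Let $G_2$ be the group of pairs $(a,\sigma)$ with $a\in\mathbb Z^m$, $\sigma\in\{1,-1\}$ and $\eta(a)=\sigma-1$ (so $\eta(a)=0$ for $\sigma=1$, ''black'', and $\eta(a)=-2$ for $\sigma=-1$, ''red''), with product $(b,\rho)(a,\sigma)=(b+\rho a,\rho\sigma)$ and identity $0=(0,1)$; since $\sigma$ is determined by $a$ we identify $(a,\sigma)$ with $a$. Let $X=\{(e_i-e_j,1):i\ne j\}\cup\{(-e_i-e_j,-1):i\neq j\}$. The Cayley graph on $G_2$ joins $g$ and $\ell g$ for $\ell\in X$. A combinatorial graph is a finite subset $A\subset G_2$ containing $0$, together with all Cayley-graph edges between its elements, assumed connected. Its rank is the rank of the subgroup of $\mathbb Z^m$ generated by its vertices; $A$ is degenerate if its rank is smaller than the number of its vertices different from $0$. In $\mathbb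 Q[t_1,\dots,t_m]$ set, for $g=(a,\sigma)$, $C(g)=\frac{\sigma}{2}\big((\sum_i a_it_i)^2+\sum_i a_it_i^2\big)$. $A$ is degenerate–resonant if it is degenerate and for every relation $\sum_k n_k a_k=0$ ($n_k\in\mathbb Z$) among its vertices $a_k\neq 0$ one has $\sum_k n_kC(a_k)=0$. $A$ is allowable if none of its vertices equals $-2e_i$ or $-3e_i+e_j$ ($i\ne j$). Given $S=(\mathtt v_1,\dots,\mathtt v_m)$, $\mathtt v_i\in\mathbb R^n$, let $\pi(a)=\sum_ia_i\mathtt v_i$ and $K(a,\sigma)=\frac{\sigma}{2}\big(|\pi(a)|^2+\sum_ia_i|\mathtt v_i|^2\big)$. A point $x\in\mathbb R^n$ is a realization of $A$ if for every vertex $g=(a,\sigma)$ of $A$: $(x,\pi(a))=K(g)$ when $\sigma=1$, and $|x|^2+(x,\pi(a))=K(g)$ when $\sigma=-1$. *)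

(* Defs.v *)
From HB Require Import structures.
From mathcomp Require Import all_boot all_order all_algebra.
From mathcomp Require Import finmap mpoly.
From mathcomp Require Import reals.

Set Implicit Arguments.
Unset Strict Implicit.
Unset Printing Implicit Defensive.

Import Order.TTheory GRing.Theory Num.Theory.

Local Open Scope ring_scope.

Definition e_ {m : nat} (i : 'I_m) : 'rV[int]_m := delta_mx 0 i.

Definition eta {m : nat} (a : 'rV[int]_m) : int := \sum_(i < m) a 0 i.

(* Pairs (a, s) with s = 1 (black) or s = -1 (red) and eta a = s - 1. *)
Record G2 (m : nat) := MkG2 {
  G2val :> 'rV[int]_m * int;
  _ : ((G2val.2 == 1) || (G2val.2 == -1)) && (eta G2val.1 == G2val.2 - 1)
}.

HB.instance Definition _ m := [isSub for @G2val m].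
HB.instance Definition _ m := [Choice of G2 m by <:].

Definition vec {m : nat} (g : G2 m) : 'rV[int]_m := (val g).1.
Definition sgn {m : nat} (g : G2 m) : int := (val g).2.

Section GroupLaw.
Variable m : nat.
Implicit Types g h : G2 m.

Lemma etaD (a b : 'rV[int]_m) : eta (a + b) = eta a + eta b.
Proof. by rewrite /eta -big_split /=; apply: eq_bigr => i _; rewrite mxE. Qed.

Lemma etaZ c (a : 'rV[int]_m) : eta (c *: a) = c * eta a.
Proof. by rewrite /eta mulr_sumr; apply: eq_bigr => i _; rewrite mxE. Qed.

Lemma sgn_cases g : sgn g = 1 \/ sgn g = -1.
Proof. by case/andP: (valP g) => /orP[] /eqP; [left | right]. Qed.

Lemma eta_vec g : eta (vec g) = sgn g - 1.
Proof. by case/andP: (valP g) => _ /eqP. Qed.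

Fact G2_one_subproof :
  (((0 : 'rV[int]_m, 1 : int).2 == 1) || ((0 : 'rV[int]_m, 1 : int).2 == -1))
  && (eta (0 : 'rV[int]_m, 1 : int).1 == (0 : 'rV[int]_m, 1 : int).2 - 1).
Proof. by rewrite /= /eta big1 // => i _; rewrite mxE. Qed.

Fact G2_mul_subproof h g (p := (vec h + sgn h *: vec g, sgn h * sgn g)) :
  ((p.2 == 1) || (p.2 == -1)) && (eta p.1 == p.2 - 1).
Proof.
rewrite /p /= etaD etaZ !eta_vec.
by case: (sgn_cases h) => ->; case: (sgn_cases g) => ->.
Qed.

Fact G2_inv_subproof g (p := (- (sgn g *: vec g), sgn g)) :
  ((p.2 == 1) || (p.2 == -1)) && (eta p.1 == p.2 - 1).
Proof.
rewrite /p /= -scaleNr etaZ eta_vec.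
by case: (sgn_cases g) => ->.
Qed.

Definition G2_one : G2 m := MkG2 G2_one_subproof.
Definition G2_mul h g : G2 m := MkG2 (G2_mul_subproof h g).
Definition G2_inv g : G2 m := MkG2 (G2_inv_subproof g).

Fact G2_mulA : associative G2_mul.
Proof.
move=> x y z; apply: val_inj; congr pair; rewrite /vec /sgn /= -/(sgn _).
  by rewrite scalerDr scalerA addrA.
by rewrite mulrA.
Qed.

Fact G2_mul1 : left_id G2_one G2_mul.
Proof.
move=> x; apply: val_inj; rewrite /= /vec /sgn /=.
by rewrite add0r scale1r mul1r -surjective_pairing.
Qed.

Fact G2_1mul : right_id G2_one G2_mul.
Proof.
move=> x; apply: val_inj; rewrite /= /vec /sgn /=.
by rewrite scaler0 addr0 mulr1 -surjective_pairing.
Qed.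

Fact G2_sgnK g : sgn g * sgn g = 1.
Proof. by case: (sgn_cases g) => ->. Qed.

Fact G2_mulV : left_inverse G2_one G2_inv G2_mul.
Proof.
move=> x; apply: val_inj; rewrite /= G2_sgnK; congr pair.
by rewrite [vec _]/= [sgn _]/= addNr.
Qed.

Fact G2_Vmul : right_inverse G2_one G2_inv G2_mul.
Proof.
move=> x; apply: val_inj; rewrite /= G2_sgnK; congr pair.
by rewrite [vec (G2_inv x)]/= scalerN scalerA G2_sgnK scale1r subrr.
Qed.

HB.instance Definition _ := isGroup.Build (G2 m)
  G2_mulA G2_mul1 G2_1mul G2_mulV G2_Vmul.

End GroupLaw.

Definition ratvec {m : nat} (a : 'rV[int]_m) : 'rV[rat]_m := map_mx intr a.

(* The rank of the subgroup of Z^m generated by the vertices of A, computed as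
   the dimension of its rational span; see [grankP]. *)
Definition grank {m : nat} (A : {fset G2 m}) : nat :=
  \rank (\matrix_(k < size A) ratvec (vec (nth 1%g A k))).

(* The subgroup of Z^m generated by the vertices of A. *)
Definition in_gen {m : nat} (A : {fset G2 m}) (v : 'rV[int]_m) : Prop :=
  exists n : G2 m -> int, v = \sum_(h <- A) vec h *~ n h.

Definition zfree {k m : nat} (b : 'I_k -> 'rV[int]_m) : Prop :=
  forall n : 'I_k -> int, \sum_i b i *~ n i = 0 -> forall i, n i = 0.

Section Rank.
Variable m : nat.

Lemma ratvec_sum I (r : seq I) (F : I -> 'rV[int]_m) (n : I -> int) :
  ratvec (\sum_(i <- r) F i *~ n i) = \sum_(i <- r) (n i)%:~R *: ratvec (F i).
Proof.
rewrite /ratvec raddf_sum; apply: eq_bigr => i _.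
by rewrite raddfMz /= scaler_int.
Qed.

Lemma ratvec0 (v : 'rV[int]_m) : ratvec v = 0 -> v = 0.
Proof.
move=> /rowP v0; apply/rowP => j; have := v0 j; rewrite !mxE.
by move/eqP; rewrite intr_eq0 => /eqP.
Qed.

Lemma clear_denom k (u : 'I_k -> rat) :
  exists2 d : int, d != 0 & exists n : 'I_k -> int,
    forall i, (n i)%:~R = d%:~R * u i.
Proof.
exists (\prod_i denq (u i)); first by apply/prodf_neq0 => i _; exact: denq_neq0.
exists (fun i => numq (u i) * \prod_(j | j != i) denq (u j)) => i.
by rewrite [in RHS](bigD1 i) //= !intrM mulrAC [_ * u i]mulrC -numqE.
Qed.

Lemma zfreeP k (b : 'I_k -> 'rV[int]_m) :
  zfree b <-> row_free (\matrix_i ratvec (b i)).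
Proof.
set B := \matrix_i _.
have mulB (u : 'rV_k) : u *m B = \sum_i u 0 i *: ratvec (b i).
  by rewrite mulmx_sum_row; apply: eq_bigr => i _; rewrite rowK.
split=> [bfree | Bfree n n0 i]; last first.
  have: (\row_i (n i)%:~R : 'rV[rat]_k) *m B = 0.
    rewrite mulB; under eq_bigr => j _ do rewrite mxE.
    by rewrite -ratvec_sum n0 /ratvec map_mx0.
  move/eqP; rewrite mulmx_free_eq0 // => /eqP/rowP/(_ i).
  by rewrite !mxE => /eqP; rewrite intr_eq0 => /eqP.
apply/inj_row_free => u; rewrite mulB => u0.
have [d d0 [n nE]] := clear_denom (u 0).
have n0 i : n i = 0.
  apply: bfree; apply: ratvec0; rewrite ratvec_sum.
  under eq_bigr => j _ do rewrite nE -scalerA.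
  by rewrite -scaler_sumr u0 scaler0.
apply/rowP => i; apply/eqP; rewrite mxE; have /esym/eqP := nE i.
by rewrite n0 mulf_eq0 intr_eq0 (negPf d0).
Qed.

Lemma grankP (A : {fset G2 m}) :
  (exists2 b : 'I_(grank A) -> 'rV[int]_m,
     forall i, in_gen A (b i) & zfree b) /\
  (forall k (b : 'I_k -> 'rV[int]_m),
     (forall i, in_gen A (b i)) -> zfree b -> (k <= grank A)%N).
Proof.
rewrite /grank; set V := \matrix_k _; split.
  pose b i := vec (nth 1%g A (maxrankfun V i)).
  exists b => [i | ].
    exists (fun h => (h == nth 1%g A (maxrankfun V i))%:Z).
    rewrite (bigD1_seq (nth 1%g A (maxrankfun V i))) ?fset_uniq ?mem_nth //=.
    rewrite eqxx mulr1z big1 ?addr0 // => h /negPf ->; exact: mulr0z.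
  apply/zfreeP; suff -> : \matrix_i ratvec (b i) = rowsub (maxrankfun V) V.
    exact: maxrowsub_free.
  by apply/row_matrixP => i; rewrite row_rowsub !rowK.
move=> k b bA /zfreeP; rewrite /row_free => /eqP <-.
apply: mxrankS; apply/row_subP => i; rewrite rowK.
have [n ->] := bA i; rewrite ratvec_sum big_seq.
apply: summx_sub => h hA; apply: scalemx_sub.
have hlt : (index h A < size A)%N by rewrite index_mem.
have -> : ratvec (vec h) = row (Ordinal hlt) V by rewrite rowK /= nth_index.
exact: row_sub.
Qed.

End Rank.

Definition gens {m : nat} : pred (G2 m) := [pred l |
  [exists i, exists j, (i != j) &&
     ((val l == (e_ i - e_ j, 1)) || (val l == (- e_ i - e_ j, -1)))]].

(* h = l * g for some l in gens; symmetric, as gens is stable under inverse *)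
Definition cayley {m : nat} : rel (G2 m) :=
  fun g h => (h * g^-1)%g \in gens.

Definition comb_graph {m : nat} (A : {fset G2 m}) : Prop :=
  1%g \in A /\
  forall g h : A, connect (fun u v : A => cayley (val u) (val v)) g h.

Definition degenerate {m : nat} (A : {fset G2 m}) : Prop :=
  (grank A < #|` A `\ 1%g|%fset)%N.

Definition C_ {m : nat} (g : G2 m) : {mpoly rat[m]} :=
  ((sgn g)%:~R / 2 : rat) *:
    ((\sum_(i < m) 'X_i *~ vec g 0 i) ^+ 2 + \sum_(i < m) 'X_i ^+ 2 *~ vec g 0 i).

Definition resonant {m : nat} (A : {fset G2 m}) : Prop :=
  forall n : G2 m -> int,
    \sum_(h <- (A `\ 1%g)%fset) vec h *~ n h = 0 ->
    \sum_(h <- (A `\ 1%g)%fset) C_ h *~ n h = 0.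

Definition degenerate_resonant {m : nat} (A : {fset G2 m}) : Prop :=
  degenerate A /\ resonant A.

Definition allowable {m : nat} (A : {fset G2 m}) : Prop :=
  forall h, h \in A ->
    (forall i, vec h <> - (e_ i *+ 2)) /\
    (forall i j, i != j -> vec h <> - (e_ i *+ 3) + e_ j).

Definition translate {m : nat} (A : {fset G2 m}) (g : G2 m) : {fset G2 m} :=
  [fset (h * g^-1)%g | h in A]%fset.

Definition dot {R : realType} {n : nat} (u v : 'rV[R]_n) : R :=
  \sum_(k < n) u 0 k * v 0 k.

Section Realization.
Context {R : realType} {m n : nat}.
Variable S : 'I_m -> 'rV[R]_n.

Definition pi_ (a : 'rV[int]_m) : 'rV[R]_n := \sum_(i < m) S i *~ a 0 i.

Definition K_ (g : G2 m) : R :=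
  (sgn g)%:~R / 2 *
    (dot (pi_ (vec g)) (pi_ (vec g)) + \sum_(i < m) dot (S i) (S i) *~ vec g 0 i).

Definition realization (A : {fset G2 m}) (x : 'rV[R]_n) : Prop :=
  forall g, g \in A ->
    (sgn g = 1 -> dot x (pi_ (vec g)) = K_ g) /\
    (sgn g = -1 -> dot x x + dot x (pi_ (vec g)) = K_ g).

End Realization.

(* Main.v *)
Require Import Defs.
From HB Require Import structures.
From mathcomp Require Import all_boot all_order all_algebra.
From mathcomp Require Import finmap mpoly.
From mathcomp Require Import reals.
From mathcomp Require Import boolp zify ring lra.

Set Implicit Arguments.
Unset Strict Implicit.
Unset Printing Implicit Defensive.

Import Order.TTheory GRing.Theory Num.Theory.

Local Open Scope ring_scope.

(** Put p(g) = sigma a for g = (a, sigma). Right translation by an element of the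
    group becomes a translation of the points p(g) up to sign, Cayley edges
    become differences of squared norm 2 (roots of type D), and h g^-1 = -2 e_i
    means p(h) - p(g) = 2 e_i. An affine relation w among the points gives a
    relation among the vertices, and resonance says exactly that
    sum_x w_x p_i(x) p_j(x) = 0 for i <> j.

    Inside A choose a connected set Q whose affine relations are the multiples
    of one w. Functions on Q orthogonal to w are affine in p, which makes the
    support of w an orthocentric system for the form sum_k u_k v_k / M_k, where
    M_k = sum_x w_x p_k(x)^2: (a-b, c-b) = 1/w_b and (a-b, c-d) = 0 for
    distinct points. Suppose that no difference is 2 e_i. Then the support of w
    is itself connected by roots, two of its edges have a common index exactly
    when they have a common vertex, and no two have the same pair of indices.
    Growing a set of points along edges, each new point brings a new index, so
    there are at least as many indices k with M_k <> 0 as points; but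
    orthogonality bounds the number of such indices by the number of points
    minus 2.

    For a realization x, the points x - pi(p(g)) are easily located: if
    p(h) - p(g) = 2 e_i then x - pi(p(g)) = v_i, and along edges the property of
    being of the form sigma v_j propagates, up to g = 0, where it reads x = v_j. *)

Lemma sum_unit (R : nmodType) (f : unit -> R) : \sum_u f u = f tt.
Proof. by rewrite (bigD1 tt) //= big1 ?addr0 // => -[]. Qed.

(** * Duality and rank for functions on a finite type *)

Section FunctionSpans.
Variables (F : fieldType) (T K : finType).

(** Double annihilator in finite dimension: each column of the cokernel of the matrix of [g] is a
    family [c] killing every [g k], and a row killed by the cokernel lies in the row space. *)
Lemma span_of_annihilator (g : K -> T -> F) (phi : T -> F) :
    (forall c : T -> F, (forall k, \sum_t c t * g k t = 0) ->
       \sum_t c t * phi t = 0) ->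
  exists z : K -> F, forall t, phi t = \sum_k z k * g k t.
Proof.
move=> ann.
pose B := \matrix_(i < #|K|, j < #|T|) g (enum_val i) (enum_val j).
pose f := \row_(j < #|T|) phi (enum_val j).
have colB l k : \sum_t cokermx B (enum_rank t) l * g k t = 0.
  have /matrixP/(_ (enum_rank k) l) := mulmx_coker B; rewrite !mxE => E.
  rewrite -[RHS]E {E}.
  rewrite (reindex_onto enum_val enum_rank) => [|t _]; last exact: enum_rankK.
  apply: eq_big => [j|j _]; first by rewrite enum_valK eqxx.
  by rewrite [B _ _]mxE enum_rankK enum_valK mulrC.
have /submxP[z fz] : (f <= B)%MS.
  rewrite submxE; apply/eqP/rowP => l; rewrite !mxE -[RHS](ann _ (colB l)).
  rewrite [RHS](reindex_onto enum_val enum_rank) => [|t _]; last exact: enum_rankK.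
  apply: eq_big => [j|j _]; first by rewrite enum_valK eqxx.
  by rewrite [f _ _]mxE enum_valK mulrC.
exists (fun k => z 0 (enum_rank k)) => t.
have /rowP/(_ (enum_rank t)) := fz; rewrite !mxE enum_rankK => ->.
rewrite (reindex_onto enum_rank enum_val) => [|k _]; last exact: enum_valK.
apply: eq_big => [k|k _]; first by rewrite enum_rankK eqxx.
by rewrite [B _ _]mxE !enum_rankK.
Qed.

(** The hypothesis makes the rows of the evaluation matrix on [P] independent, so its rank [#|K|] is
    bounded by its number of columns. *)
Lemma leq_card_free (g : K -> T -> F) (P : {set T}) :
    (forall u : K -> F, (forall t, t \in P -> \sum_k u k * g k t = 0) ->
       forall k, u k = 0) ->
  (#|K| <= #|P|)%N.
Proof.
move=> free.
pose B := \matrix_(i < #|K|, j < #|P|) g (enum_val i) (enum_val j).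
suff /eqP <- : row_free B by exact: rank_leq_col.
apply/inj_row_free => v /rowP vB.
apply/rowP => i; rewrite mxE -[i]enum_valK.
apply: (free (fun k => v 0 (enum_rank k))) => t tP.
have := vB (enum_rank_in tP t); rewrite !mxE => E.
rewrite -[RHS]E {E}.
rewrite (reindex_onto enum_val enum_rank) => [|k _]; last exact: enum_rankK.
apply: eq_big => [j|j _]; first by rewrite enum_valK eqxx.
by rewrite [B _ _]mxE enum_valK enum_rankK_in.
Qed.

End FunctionSpans.

(** * Connectedness expressed by cuts *)

Section CutConnected.
Variables (T : finType) (e : rel T).

(** Phrased by cuts because the arguments below ask for an edge leaving a given subset. *)
Definition cut_connected (Q : {set T}) :=
  forall S : {set T}, S \subset Q -> S != set0 -> S != Q ->
    exists x y, [/\ x \in S, y \in Q, y \notin S & e x y].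

Lemma cut_connected1 x : cut_connected [set x].
Proof.
by move=> S; rewrite subset1 => /orP[]/eqP ->; rewrite ?eqxx.
Qed.

Lemma cut_connectedU1 (Q : {set T}) x y :
  ssrbool.symmetric e -> cut_connected Q -> x \in Q -> e x y -> cut_connected (y |: Q).
Proof.
move=> esym Qc xQ exy S SyQ S0 SyQn.
have [yS | yS] := boolP (y \in S); last first.
  have SQ : S \subset Q.
    apply/subsetP => z zS; have /setU1P[zy|//] := subsetP SyQ z zS.
    by rewrite zy (negPf yS) in zS.
  have [SeQ|SnQ] := eqVneq S Q.
    by exists x, y; rewrite SeQ xQ setU11 -SeQ.
  have [a [b [aS bQ bS eab]]] := Qc _ SQ S0 SnQ.
  by exists a, b; rewrite aS setU1r // bS.
have [QS | /subsetPn[z zQ zS]] := boolP (Q \subset S).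
  case/eqP: SyQn; apply/eqP; rewrite eqEsubset SyQ /=.
  by apply/subsetP => z /setU1P[->//|/(subsetP QS)].
have [SQ0 | SQ0] := eqVneq (S :&: Q) set0.
  exists y, x; rewrite yS setU1r //= esym; split=> //.
  by apply/negP => xS; have := in_set0 x; rewrite -SQ0 inE xS xQ.
have [|a [b [/setIP[aS aQ] bQ bS eab]]] := Qc (S :&: Q) (subsetIr _ _) SQ0.
  by apply/eqP => SQQ; have := zQ; rewrite -{1}SQQ inE (negPf zS).
by exists a, b; split=> //; [rewrite setU1r | rewrite inE bQ andbT in bS].
Qed.

(* The path is a sequence [u 0, u 1, ..., u r]; its values beyond [r] are junk. *)
Lemma cut_connected_path (Q : {set T}) a b :
  cut_connected Q -> a \in Q -> b \in Q ->
  exists r (u : nat -> T), [/\ u 0%N = a, u r = b,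
    forall t, (t <= r)%N -> u t \in Q
    & forall t, (t < r)%N -> e (u t) (u t.+1)].
Proof.
move=> Qc aQ bQ.
pose ee x y := [&& x \in Q, y \in Q & e x y].
pose S := [set x in Q | connect ee a x].
have SQ : S = Q.
  apply/eqP/negPn/negP => SQ.
  have [||x [y [/setIdP[xQ ax] yQ yS exy]]] := Qc S _ _ SQ.
  - by apply/subsetP => x /setIdP[].
  - by apply/set0Pn; exists a; rewrite inE aQ connect0.
  case/negP: yS; rewrite inE yQ /=; apply: connect_trans ax (connect1 _).
  by rewrite /ee xQ yQ.
have /setIdP[_ /connectP[s sp ->]] : b \in S by rewrite SQ.
exists (size s), (nth a (a :: s)); split=> //.
- by rewrite -last_nth.
- by case=> [//|t] lt; have /and3P[] := pathP a sp t lt.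
- by move=> t lt; have /and3P[] := pathP a sp t lt.
Qed.

End CutConnected.

(** * Affine relations and one-dimensional relation spaces *)

Section AffineRelations.
Variables (T K : finType) (p : T -> K -> int).

Definition affine_relation (Q : {set T}) (w : T -> rat) :=
  [/\ forall x, x \notin Q -> w x = 0, \sum_x w x = 0
    & forall k, \sum_x w x * (p x k)%:~R = 0].

(** Here [w] may vanish on part of [Q]; its support is the circuit in the sense of matroids. *)
Definition is_circuit_space (Q : {set T}) (w : T -> rat) :=
  [/\ affine_relation Q w, exists x, w x != 0 &
    forall v, affine_relation Q v -> exists c, forall x, v x = c * w x].

Lemma affine_relation_lin Q v w c :
  affine_relation Q v -> affine_relation Q w ->
  affine_relation Q (fun x => v x - c * w x).
Proof.
move=> [v0 v1 v2] [w0 w1 w2]; split=> [x xQ | | k].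
- by rewrite v0 ?w0 // mulr0 subr0.
- by rewrite sumrB -mulr_sumr v1 w1 mulr0 subr0.
- under eq_bigr => x _ do rewrite mulrBl -mulrA.
  by rewrite sumrB -mulr_sumr v2 w2 mulr0 subr0.
Qed.

(** Enlarge a maximal connected set without nonzero relation by one neighbour [y]. Maximality yields
    a nonzero relation, necessarily nonzero at [y]; from any other relation one subtracts a multiple
    of it to get the value 0 at [y], hence everywhere. *)
Lemma connected_circuit_space (e : rel T) (v : T -> rat) :
  ssrbool.symmetric e -> cut_connected e setT ->
  affine_relation setT v -> (exists x, v x != 0) ->
  exists Q w, cut_connected e Q /\ is_circuit_space Q w.
Proof.
move=> esym Tc relv [x0 vx0].
pose good (Q : {set T}) := cut_connected e Q /\
  forall w, affine_relation Q w -> forall x, w x = 0.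
have good1 : good [set x0].
  split=> [|w [w0 w1 _] x]; first exact: cut_connected1.
  have [->|xx0] := eqVneq x x0; last by rewrite w0 ?inE.
  rewrite -w1 (bigD1 x0) //= big1 ?addr0 // => y yx0.
  by rewrite w0 ?inE.
have [Q /maxsetP[/asboolP[Qc Qfree] Qmax] _] :=
  @maxset_exists _ (fun Q => `[<good Q>]) _ (introT (asboolP _) good1).
have Q0 : Q != set0.
  apply/eqP => Q0; have := Qmax [set x0] (introT (asboolP _) good1).
  rewrite Q0 sub0set => /(_ isT)/setP/(_ x0).
  by rewrite !inE eqxx.
have QT : Q != setT.
  by apply/eqP => QT; move: vx0; rewrite (Qfree v) ?eqxx // QT.
have [x [y [xQ _ yQ exy]]] := Tc Q (subsetT Q) Q0 QT.
have Qyc := cut_connectedU1 esym Qc xQ exy.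
have [w relw [z wz]] : exists2 w, affine_relation (y |: Q) w & exists x, w x != 0.
  have ngood : ~ good (y |: Q).
    move=> /(introT (asboolP _)) g; move: yQ.
    by rewrite -(Qmax _ g (subsetUr _ _)) setU11.
  case: (pselect (exists2 w, affine_relation (y |: Q) w & exists x, w x != 0))=> // nw.
  case: ngood; split=> // w rw t; apply/eqP/negPn/negP => wt.
  by case: nw; exists w => //; exists t.
have restr u : affine_relation (y |: Q) u -> u y = 0 -> forall t, u t = 0.
  move=> [u0 u1 u2] uy; apply: Qfree; split=> // t tQ.
  by have [->//|ty] := eqVneq t y; rewrite u0 // !inE negb_or ty.
have wy : w y != 0 by apply/eqP => wy; rewrite (restr _ relw wy) eqxx in wz.
exists (y |: Q), w; split=> //; split=> [//||u relu]; first by exists z.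
exists (u y / w y) => t; apply/eqP; rewrite -subr_eq0; apply/eqP.
apply: (restr _ (affine_relation_lin (u y / w y) relu relw)).
by rewrite divfK // subrr.
Qed.

End AffineRelations.

(** * Integer vectors of small norm *)

Section Roots.
Variable K : finType.
Implicit Type d : K -> int.

(* The integer vectors of squared norm 2 are the roots +-e_i +- e_j of D_K. *)
Definition root_vector d := \sum_k d k ^+ 2 == 2.

Definition vsupp d := [set k | d k != 0].

Lemma in_vsupp d k : (k \in vsupp d) = (d k != 0).
Proof. by rewrite inE. Qed.

Lemma sum_vsupp (R : nmodType) d (f : K -> R) :
  (forall k, d k = 0 -> f k = 0) -> \sum_k f k = \sum_(k in vsupp d) f k.
Proof.
move=> f0; rewrite [RHS]big_mkcond; apply: eq_bigr => k _ /=.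
by rewrite inE; case: eqVneq => [/f0|].
Qed.

Lemma exists_neq0_sum (P : pred K) d :
  \sum_(k | P k) d k != 0 -> exists2 k, P k & d k != 0.
Proof.
case: (pickP (fun k => P k && (d k != 0))) => [k /andP[Pk dk] _ | d0].
  by exists k.
rewrite big1 ?eqxx // => k Pk; apply/eqP; have := d0 k.
by rewrite Pk /= => /negbT; rewrite negbK.
Qed.

Lemma int_sqr_lt4 (x : int) : x ^+ 2 != 0 -> x ^+ 2 < 4 -> x = 1 \/ x = -1.
Proof.
rewrite expf_eq0 /= -real_normK ?num_real // => x0.
by have [|] := leP `|x| 1; [lia | nia].
Qed.

Lemma root_vectorP d : root_vector d ->
  exists i j, [/\ i != j, vsupp d = [set i; j],
    d i = 1 \/ d i = -1 & d j = 1 \/ d j = -1].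
Proof.
move=> /eqP dd.
have ge0 (P : pred K) : 0 <= \sum_(k | P k) d k ^+ 2.
  by apply: sumr_ge0 => k _; rewrite sqr_ge0.
have [|i _ di0] := @exists_neq0_sum predT (fun k => d k ^+ 2); first by rewrite dd.
have di : d i = 1 \/ d i = -1.
  apply: int_sqr_lt4 => //.
  move: dd; rewrite (bigD1 i) //=; have /= := ge0 (fun k => k != i).
  by set s := \sum_(_ | _) _; lia.
have si : \sum_(k | k != i) d k ^+ 2 = 1.
  by move: dd; rewrite (bigD1 i) //=; set s := \sum_(_ | _) _; case: di => ->; lia.
have [|j ji dj0] := @exists_neq0_sum (fun k => k != i) (fun k => d k ^+ 2).
  by rewrite si.
have dj : d j = 1 \/ d j = -1.
  apply: int_sqr_lt4 => //; move: si; rewrite (bigD1 j) //=.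
  have /= := ge0 (fun k => (k != i) && (k != j)).
  by set s := \sum_(_ | _) _; lia.
have sj : \sum_(k | (k != i) && (k != j)) d k ^+ 2 = 0.
  by move: si; rewrite (bigD1 j) //=; set s := \sum_(_ | _) _; case: dj => ->; lia.
exists i, j; split=> //; first by rewrite eq_sym.
apply/setP => k; rewrite !inE.
have [->|ki] := eqVneq k i; first by case: di => ->.
have [->|kj] := eqVneq k j; first by case: dj => ->.
rewrite -sqrf_eq0 (psumr_eq0P _ sj) ?eqxx ?ki //.
by move=> l _; rewrite sqr_ge0.
Qed.

(** The norm bound leaves [+-e_i], [+-e_i +- e_j] and [+-2 e_i]; the parity of the coordinate sum
    discards the first kind. *)
Lemma root_or_double d :
  \sum_k `|d k| <= 2 -> (exists c, \sum_k d k = c * 2) -> (exists k, d k != 0) ->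
  root_vector d \/
  exists i s, (s = 2 \/ s = -2) /\ forall k, d k = if k == i then s else 0.
Proof.
move=> d2 [c dc] [i di0].
have ge0 (P : pred K) : 0 <= \sum_(k | P k) `|d k| by apply: sumr_ge0.
have zero (P : pred K) : \sum_(k | P k) `|d k| <= 0 -> forall k, P k -> d k = 0.
  move=> s0 k Pk; apply/eqP; rewrite -normr_eq0.
  have /psumr_eq0P -> // : \sum_(k | P k) `|d k| = 0.
  by apply/eqP; rewrite eq_le s0 ge0.
move: d2; rewrite (bigD1 i) //= => d2.
have [di1 | di2] := leP `|d i| 1; last first.
  right; exists i, (d i); split.
    have /= := ge0 (fun k => k != i).
    by set s := \sum_(_ | _) _ in d2 *; lia.
  move=> k; case: eqVneq => [->//|]; apply: (zero (fun k => k != i)).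
  by rewrite /=; set s := \sum_(_ | _) _ in d2 *; lia.
left; move: dc; rewrite (bigD1 i) //= => dc.
have [j ji dj0] : exists2 j, j != i & d j != 0.
  by apply: exists_neq0_sum; set s := \sum_(_ | _) _ in dc *; lia.
move: d2; rewrite (bigD1 j) //= => d2.
have {}zero := zero (fun k => (k != i) && (k != j)).
rewrite /root_vector (bigD1 i) //= (bigD1 j) //= big1 => [|k kij].
  have /= := ge0 (fun k => (k != i) && (k != j)).
  by set s := \sum_(_ | _) _ in d2 *; nia.
rewrite zero //=; set s := \sum_(_ | _) _ in d2 *; lia.
Qed.

Lemma sum_vsupp2 (R : nmodType) d i j (f : K -> R) :
  i != j -> vsupp d = [set i; j] -> (forall k, d k = 0 -> f k = 0) ->
  \sum_k f k = f i + f j.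
Proof.
move=> ij dij /sum_vsupp ->; rewrite dij big_setU1 ?big_set1 //.
by rewrite inE.
Qed.

Lemma root_at d k : root_vector d -> k \in vsupp d ->
  exists j, [/\ k != j, vsupp d = [set k; j],
    d k = 1 \/ d k = -1 & d j = 1 \/ d j = -1].
Proof.
move=> /root_vectorP[i [j [ij -> di dj]]] /set2P[] ->; first by exists j.
by exists i; rewrite eq_sym setUC.
Qed.

Lemma root_vsupp2 d k l : root_vector d -> k != l ->
  k \in vsupp d -> l \in vsupp d -> vsupp d = [set k; l].
Proof.
move=> rd kl /(root_at rd)[j [kj -> _ _]] /set2P[lk|->//].
by rewrite lk eqxx in kl.
Qed.

End Roots.

(** A vector orthogonal to a root has entries of equal absolute value at the two indices of the
    root, once the masses of these indices agree up to sign. *)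
Lemma pm_of_weighted (m n : rat) (e f x y : int) (s : rat) :
  m != 0 -> n = s * m -> s = 1 \/ s = -1 -> e = 1 \/ e = -1 -> f = 1 \/ f = -1 ->
  e%:~R * x%:~R / m + f%:~R * y%:~R / n = 0 -> x = y \/ x = - y.
Proof.
move=> m0 -> s1 e1 f1 E.
have {}E : e%:~R * x%:~R * s + f%:~R * y%:~R = 0 :> rat.
  have s0 : s != 0 by case: s1 => ->.
  have -> : e%:~R * x%:~R * s + f%:~R * y%:~R
     = (e%:~R * x%:~R / m + f%:~R * y%:~R / (s * m)) * (s * m) :> rat.
    by field; rewrite m0 s0.
  by rewrite E mul0r.
suff : (x%:~R == y%:~R :> rat) || (x%:~R == (- y)%:~R :> rat).
  by rewrite !eqr_int => /orP[]/eqP; [left | right].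
rewrite rmorphN /=.
case: s1 e1 f1 E => -> [] -> [] ->; rewrite ?(rmorphN1, rmorph1) => E; apply/orP;
  by [left; apply/eqP; lra | right; apply/eqP; lra].
Qed.

(** Both numerators are [+-1]. This is applied to two orthogonal edges with the same pair of
    indices. *)
Lemma opposite_masses (m n : rat) (e f e' f' : int) :
  m != 0 -> n != 0 -> e = 1 \/ e = -1 -> f = 1 \/ f = -1 ->
  e' = 1 \/ e' = -1 -> f' = 1 \/ f' = -1 ->
  e%:~R * e'%:~R / m + f%:~R * f'%:~R / n = 0 ->
  exists2 s, s = 1 \/ s = -1 & n = s * m.
Proof.
move=> m0 n0 e1 f1 e1' f1' E.
have {}E : e%:~R * e'%:~R * n + f%:~R * f'%:~R * m = 0 :> rat.
  have -> : e%:~R * e'%:~R * n + f%:~R * f'%:~R * m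
     = (e%:~R * e'%:~R / m + f%:~R * f'%:~R / n) * (m * n) :> rat.
    by field; rewrite m0 n0.
  by rewrite E mul0r.
have [] : n = m \/ n = - m.
- by case: e1 f1 e1' f1' E => -> [] -> [] -> [] ->;
    rewrite ?(rmorphN1, rmorph1) => E; by [left; lra | right; lra].
- by exists 1; [left | rewrite mul1r].
- by exists (-1); [right | rewrite mulN1r].
Qed.

(** * The orthocentric geometry of the support of a circuit relation *)

Section Circuit.
Variables (T K : finType) (p : T -> K -> int) (Q : {set T}) (w : T -> rat).
Hypothesis p_inj : forall x y, (forall k, p x k = p y k) -> x = y.
Hypothesis Qw : is_circuit_space p Q w.
Hypothesis w_diag : forall i j, i != j ->
  \sum_x w x * (p x i)%:~R * (p x j)%:~R = 0.

Definition supp := [set x | w x != 0].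
(** The diagonal of the [w]-weighted Gram matrix of the coordinates, whose other entries vanish by
    [w_diag]. *)
Definition mass i := \sum_x w x * (p x i)%:~R * (p x i)%:~R.
Definition massive := [set i | mass i != 0].
Definition diff x y k := p x k - p y k.
(* For a massless index the junk value [u k * v k / 0 = 0] is what is wanted. *)
Definition mform (u v : K -> int) : rat :=
  \sum_k (u k)%:~R * (v k)%:~R / mass k.

Let wsum0 : \sum_x w x = 0. Proof. by have [[]] := Qw. Qed.
Let wp0 k : \sum_x w x * (p x k)%:~R = 0. Proof. by have [[_ _ ->]] := Qw. Qed.
Let wQ x : x \notin Q -> w x = 0. Proof. by have [[h _ _] _ _] := Qw; apply: h. Qed.

Lemma suppP x : reflect (w x <> 0) (x \in supp).
Proof. by rewrite inE; apply: (iffP idP) => /eqP. Qed.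

Lemma supp_sub : supp \subset Q.
Proof. by apply/subsetP => x /suppP wx; apply: contra_notT wx => /wQ. Qed.

Lemma sum_gram (u : K -> rat) j :
  \sum_x w x * (\sum_k u k * (p x k)%:~R) * (p x j)%:~R = u j * mass j.
Proof.
under eq_bigr => x _ do rewrite mulr_sumr mulr_suml.
rewrite exchange_big (bigD1 j) //= [X in _ + X]big1 ?addr0 => [|k kj].
  by rewrite /mass mulr_sumr; apply: eq_bigr => x _; ring.
transitivity (u k * \sum_x w x * (p x k)%:~R * (p x j)%:~R); last first.
  by rewrite w_diag ?mulr0.
rewrite mulr_sumr.
by apply: eq_bigr => x _; ring.
Qed.

(** All relations on [Q] are multiples of [w], so [phi] is killed by all of them and is affine in
    [p] on [Q] by duality. Pairing with [w] times a coordinate removes the constant and, the Gram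
    matrix being diagonal, isolates [z i]. *)
Lemma affine_extension (phi : T -> rat) : \sum_x w x * phi x = 0 ->
  exists c (z : K -> rat),
    (forall x, x \in Q -> phi x = c + \sum_k z k * (p x k)%:~R) /\
    (forall i, z i * mass i = \sum_x w x * phi x * (p x i)%:~R).
Proof.
move=> wphi.
(* The constant function and the coordinates, cut off outside [Q]: a family killing them restricts
   to an affine relation on [Q]. *)
pose g (o : unit + K) x : rat :=
  if x \in Q then if o is inr k then (p x k)%:~R else 1 else 0.
have [c0 h | z zE] := @span_of_annihilator _ T _ g
  (fun x => if x \in Q then phi x else 0).
  pose v x := if x \in Q then c0 x else 0.
  have relv : affine_relation p Q v.
    split=> [x /negPf xQ | | k]; first by rewrite /v xQ.
      rewrite -[RHS](h (inl tt)); apply: eq_bigr => x _; rewrite /g /v.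
      by case: ifP; rewrite ?mulr1 ?mulr0.
    rewrite -[RHS](h (inr k)); apply: eq_bigr => x _; rewrite /g /v.
    by case: ifP; rewrite ?mul0r ?mulr0.
  have [_ _ /(_ _ relv)[c vE]] := Qw.
  transitivity (c * \sum_x w x * phi x); last by rewrite wphi mulr0.
  rewrite mulr_sumr; apply: eq_bigr => x _.
  by rewrite mulrA -vE /v; case: ifP => _; rewrite ?mulr0 ?mul0r.
have phiE x : x \in Q -> phi x = z (inl tt) + \sum_k z (inr k) * (p x k)%:~R.
  move=> xQ; have := zE x; rewrite xQ big_sumType sum_unit /= /g xQ => ->.
  by rewrite mulr1.
exists (z (inl tt)), (fun k => z (inr k)); split=> // i.
rewrite /= -(sum_gram (fun k => z (inr k))).
transitivity (\sum_x w x * phi x * (p x i)%:~R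
  - z (inl tt) * \sum_x w x * (p x i)%:~R); last by rewrite wp0 mulr0 subr0.
rewrite mulr_sumr -sumrB; apply: eq_bigr => x _.
have [/phiE ->|/wQ ->] := boolP (x \in Q); ring.
Qed.

(** Normalized so that pairing with [w] gives the difference of the evaluations at [x] and [y]; in
    particular it is orthogonal to [w]. *)
Definition bump x y t : rat := (t == x)%:R / w x - (t == y)%:R / w y.

Lemma sum_bump x y (f : T -> rat) : x \in supp -> y \in supp ->
  \sum_t w t * bump x y t * f t = f x - f y.
Proof.
move=> /suppP/eqP wx /suppP/eqP wy.
have delta z : w z != 0 -> \sum_t w t * ((t == z)%:R / w z) * f t = f z.
  move=> wz; rewrite (bigD1 z) //= eqxx big1 => [|t /negPf ->].
    by rewrite mul1r mulfV // mul1r addr0.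
  by rewrite mul0r mulr0 mul0r.
rewrite -(delta x wx) -(delta y wy) -sumrB; apply: eq_bigr => t _.
by rewrite /bump; ring.
Qed.

Lemma bump_extension x y : x \in supp -> y \in supp ->
  exists c (z : K -> rat),
    (forall t, t \in Q -> bump x y t = c + \sum_k z k * (p t k)%:~R) /\
    (forall i, z i * mass i = (diff x y i)%:~R).
Proof.
move=> xS yS; have [|c [z [h1 h2]]] := @affine_extension (bump x y).
  by under eq_bigr do rewrite -[_ * _]mulr1; rewrite (sum_bump (fun=> 1)) // subrr.
exists c, z; split=> // i.
by rewrite h2 (sum_bump (fun t => (p t i)%:~R)) // -rmorphB.
Qed.

Lemma massless_diff x y i :
  x \in supp -> y \in supp -> i \notin massive -> p x i = p y i.
Proof.
move=> xS yS; rewrite inE negbK => /eqP mi.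
have [c [z [_ /(_ i)]]] := bump_extension xS yS.
by rewrite mi mulr0 => /esym/eqP; rewrite intr_eq0 subr_eq0 => /eqP.
Qed.

(** On [Q], [bump a b] is affine with gradient [diff a b / mass] at the massive indices, so the form
    computes its variation from [d] to [c]. At massless indices [c] and [d] agree. *)
Lemma mform_bump a b c d :
  a \in supp -> b \in supp -> c \in supp -> d \in supp ->
  mform (diff a b) (diff c d) = bump a b c - bump a b d.
Proof.
move=> aS bS cS dS; have [e [z [zE zM]]] := bump_extension aS bS.
rewrite !zE ?(subsetP supp_sub) // opprD addrACA subrr add0r -sumrB.
apply: eq_bigr => k _; rewrite -mulrBr -rmorphB /=.
have [mk | mk] := boolP (k \in massive).
  by rewrite -zM mulrAC mulfK //; rewrite inE in mk.
by rewrite /diff (massless_diff cS dS mk) subrr !(mulr0, mul0r).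
Qed.

Lemma mform_adjacent a b c : a \in supp -> b \in supp -> c \in supp ->
  a != b -> c != a -> c != b -> mform (diff a b) (diff c b) = (w b)^-1.
Proof.
move=> aS bS cS /negPf ab /negPf ca /negPf cb.
rewrite mform_bump // /bump ca cb eqxx (eq_sym b) ab !mul0r subrr !sub0r opprK.
by rewrite mul1r.
Qed.

Lemma mform_disjoint a b c d :
  a \in supp -> b \in supp -> c \in supp -> d \in supp ->
  c != a -> c != b -> d != a -> d != b -> mform (diff a b) (diff c d) = 0.
Proof.
move=> aS bS cS dS /negPf ca /negPf cb /negPf da /negPf db.
by rewrite mform_bump // /bump ca cb da db !mul0r subrr.
Qed.

(** The constant 1, the indicator of a point [a] of the support and the massive coordinates are
    independent on [supp]: pairing a combination with [w] kills the coefficient of the indicator,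
    pairing with [w] times a coordinate kills that of the coordinate, and the constant is left. *)
Lemma massive_lt_supp : (#|massive| + 2 <= #|supp|)%N.
Proof.
have [_ [a wa] _] := Qw.
pose I := {i | i \in massive}.
pose g (o : bool + I) (x : T) : rat := match o with
  | inl true => 1 | inl false => (x == a)%:R | inr i => (p x (val i))%:~R end.
suff : (#|{: bool + I}| <= #|supp|)%N.
  by rewrite card_sum card_bool card_sig addnC.
apply: (@leq_card_free _ T _ g) => u u0.
have {}u0 x : w x * (u (inl true) + u (inl false) * (x == a)%:R
    + \sum_i u (inr i) * (p x (val i))%:~R) = 0.
  have [wx|wx] := eqVneq (w x) 0; first by rewrite wx mul0r.
  have := u0 x; rewrite inE wx => /(_ isT); rewrite big_sumType big_bool /=.
  by rewrite /g mulr1 => ->; rewrite mulr0.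
have uf : u (inl false) = 0.
  apply: (mulfI wa); rewrite mulr0.
  have : \sum_x w x * (u (inl true) + u (inl false) * (x == a)%:R
    + \sum_i u (inr i) * (p x (val i))%:~R) = 0 by rewrite big1.
  under eq_bigr do rewrite !mulrDr; rewrite !big_split /= -mulr_suml wsum0 mul0r add0r.
  rewrite [X in X + _](bigD1 a) //= eqxx big1 ?addr0 => [|x /negPf ->]; last first.
    by rewrite !mulr0.
  under [X in _ + X]eq_bigr do rewrite mulr_sumr.
  rewrite exchange_big big1 ?addr0 => [|i _]; first by rewrite mulr1.
  transitivity (u (inr i) * \sum_x w x * (p x (val i))%:~R); last first.
    by rewrite wp0 mulr0.
  by rewrite mulr_sumr; apply: eq_bigr => x _; ring.
have ui i : u (inr i) = 0.
  have mi : mass (val i) != 0 by have := valP i; rewrite inE.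
  apply: (mulIf mi); rewrite mul0r.
  have : \sum_x w x * (u (inl true) + u (inl false) * (x == a)%:R
    + \sum_i u (inr i) * (p x (val i))%:~R) * (p x (val i))%:~R = 0.
    by rewrite big1 // => x _; rewrite u0 mul0r.
  rewrite uf; under eq_bigr do rewrite mul0r addr0 mulrDr mulrDl mulr_sumr mulr_suml.
  rewrite big_split /= exchange_big (bigD1 i) //= => <-.
  rewrite [X in X + _](_ : _ = 0) ?add0r; last first.
    transitivity (u (inl true) * \sum_x w x * (p x (val i))%:~R).
      by rewrite mulr_sumr; apply: eq_bigr => x _; ring.
    by rewrite wp0 mulr0.
  rewrite [X in _ + X]big1 ?addr0 => [|j ji].
    by rewrite /mass mulr_sumr; apply: eq_bigr => x _; ring.
  transitivity (u (inr j) * \sum_x w x * (p x (val j))%:~R * (p x (val i))%:~R).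
    by rewrite mulr_sumr; apply: eq_bigr => x _; ring.
  by rewrite w_diag ?mulr0.
move=> [[]|//] //; apply: (mulfI wa); rewrite mulr0 -[RHS](u0 a) uf.
by rewrite big1 => [|i _]; rewrite ?ui; ring.
Qed.

Definition adj : rel T := fun x y => root_vector (diff x y).

Lemma adj_sym : ssrbool.symmetric adj.
Proof.
move=> x y; rewrite /adj /root_vector; congr (_ == _).
by apply: eq_bigr => k _; rewrite -sqrrN opprB.
Qed.

Lemma adj_neq x y : adj x y -> x != y.
Proof.
apply: contraTneq => ->; rewrite /adj /root_vector big1 // => k _.
by rewrite /diff subrr.
Qed.

Hypothesis no_double : forall x y i, x \in Q -> y \in Q ->
  ~ (forall k, diff x y k = if k == i then 2 else 0).

Lemma no_double_sign x y i s : x \in Q -> y \in Q -> s = 2 \/ s = -2 ->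
  ~ (forall k, diff x y k = if k == i then s else 0).
Proof.
move=> xQ yQ [] -> d; first exact: no_double xQ yQ d.
apply: (no_double yQ xQ (i := i)) => k.
by have := d k; rewrite /diff; case: ifP => _; lia.
Qed.

(** * Paths that meet the support only at their ends *)

Section ShortestPath.
Variables (S : {set T}) (r : nat) (u : nat -> T).
Hypothesis u0S : u 0%N \in S.
Hypothesis SP : S \subset supp.
Hypothesis urP : u r \in supp.
Hypothesis urS : u r \notin S.
Hypothesis uQ : forall t, (t <= r)%N -> u t \in Q.
Hypothesis uadj : forall t, (t < r)%N -> adj (u t) (u t.+1).
Hypothesis u_out : forall t, (0 < t < r)%N -> u t \notin supp.
Hypothesis u_inj : forall s t, (s <= r)%N -> (t <= r)%N -> u s = u t -> s = t.
Hypothesis r_gt1 : (1 < r)%N.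

Let step t := diff (u t.+1) (u t).

Let step_root t : (t < r)%N -> root_vector (step t).
Proof. by move/uadj; rewrite adj_sym. Qed.

Lemma sum_step k : \sum_(t < r) step t k = diff (u r) (u 0%N) k.
Proof. by rewrite -(big_mkord xpredT (fun t => step t k)) telescope_sumr. Qed.

(** Transport [h] to the path and extend it by 0. The result vanishes on the support, so it is
    orthogonal to [w] and to [w] times every coordinate; its gradient is therefore 0 at massive
    indices. *)
Lemma prescribed_jumps (h : nat -> rat) : h 0%N = 0 -> h r = 0 ->
  exists z : K -> rat, (forall i, i \in massive -> z i = 0) /\
    forall t, (t < r)%N -> \sum_k z k * (step t k)%:~R = h t.+1 - h t.
Proof.
move=> h0 hr.
pose phi x := \sum_(t < r) if x == u t then h t else 0.
have phiE s : (s <= r)%N -> phi (u s) = h s.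
  rewrite leq_eqVlt => /orP[/eqP ->|sr].
    rewrite /phi hr big1 // => t _; case: eqP => // /u_inj e.
    by have := ltn_ord t; rewrite -e ?ltnn // ltnW.
  rewrite /phi (bigD1 (Ordinal sr)) //= eqxx big1 ?addr0 // => t ts.
  case: eqP => // /u_inj e; case/eqP: ts; apply: val_inj => /=.
  by rewrite e // ltnW.
have wphi x : w x * phi x = 0.
  have [xP|] := boolP (x \in supp); last first.
    by rewrite inE negbK => /eqP ->; rewrite mul0r.
  rewrite /phi big1 ?mulr0 // => t _; case: eqP => // xt.
  have [->//|t0] := posnP t.
  by have := @u_out t; rewrite t0 ltn_ord -xt xP => /(_ isT).
have [|c [z [zE zM]]] := @affine_extension phi; first by rewrite big1.
exists z; split=> [i | t tr].
  rewrite inE => mi; apply: (mulIf mi); rewrite zM mul0r big1 // => x _.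
  by rewrite wphi mul0r.
rewrite -!phiE ?(ltnW tr) // !zE ?uQ ?(ltnW tr) // opprD addrACA subrr add0r.
by rewrite -sumrB; apply: eq_bigr => k _; rewrite -mulrBr -rmorphB.
Qed.

(** By [step_massless] below, such a step has exactly one massive index and one massless index. *)
Let half t := [exists k in massive, step t k != 0].

(** Otherwise both indices of the step are massive, and no function as in [prescribed_jumps] could
    jump there. *)
Lemma step_massless t : (t < r)%N ->
  exists2 k, step t k != 0 & k \notin massive.
Proof.
move=> tr; have [i [j [ij ijs di dj]]] := root_vectorP (step_root tr).
(* A peak at one end of step [t], chosen strictly between 0 and [r]: its start, or its end 1 when
   [t] is 0, which is below [r] by [r_gt1]. *)
pose h s : rat := (s == (if t == 0 then 1 else t)%N)%:R.
have [||z [z0 zE]] := @prescribed_jumps h.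
- by rewrite /h; case: (t).
- rewrite /h (_ : (r == _) = false) //; apply/negbTE.
  by case: ifP => _; rewrite neq_ltn ?r_gt1 ?tr orbT.
have hn : h t.+1 - h t != 0.
  by rewrite /h; case: (t) => [|s] //=; rewrite eqxx (gtn_eqF (ltnSn _)).
have := zE t tr; rewrite (sum_vsupp2 ij ijs) => [E|l ->]; last by rewrite mulr0.
have dn l : l \in [set i; j] -> step t l != 0 by rewrite -ijs in_vsupp.
have [im|im] := boolP (i \in massive); last first.
  by exists i; rewrite ?dn ?set21.
exists j; rewrite ?dn ?set22 //; apply: contra hn => jm.
by rewrite -E !z0 // !mul0r addr0.
Qed.

Lemma massive_part_step t : (t < r)%N ->
  \sum_(k in massive) `|step t k| <= (half t)%:R.
Proof.
move=> tr; have [i [j [ij ijs di dj]]] := root_vectorP (step_root tr).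
rewrite big_mkcond (sum_vsupp2 ij ijs) => [|l ->]; last by case: ifP.
have h l : l \in [set i; j] -> l \in massive -> half t.
  by move=> lij lm; apply/existsP; exists l; rewrite lm /= -in_vsupp ijs.
have [k] := step_massless tr; rewrite -in_vsupp ijs.
have d1 l : l \in [set i; j] -> `|step t l| = 1.
  by case/set2P => ->; [case: di | case: dj] => ->.
rewrite !d1 ?set21 ?set22 // => /set2P[] -> /negPf km; rewrite km ?add0r ?addr0.
  by case: ifP => // jm; rewrite (h j) ?set22.
by case: ifP => // im; rewrite (h i) ?set21.
Qed.

(* Prescribe the jumps 1, 1, -2 on three half steps and 0 on the others, and cut
   the resulting functional off to the indices where it takes the values +-2:
   the cut functional has a single nonzero jump, yet it vanishes at the end. *)
Lemma card_half_le2 : (#|[set t : 'I_r | half t]| <= 2)%N.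
Proof.
rewrite leqNgt; apply/negP => /card_gt2P[t1 [t2 [t3 [[h1 h2 h3] [n12 n23 n31]]]]].
rewrite !inE in h1 h2 h3.
pose h s : rat := (t1 < s)%:R + (t2 < s)%:R - 2 * (t3 < s)%:R.
have [||z [z0 zE]] := @prescribed_jumps h.
- by rewrite /h /=; ring.
- by rewrite /h !ltn_ord /=; ring.
pose cut k := `|z k| == 2.
have jump (t : 'I_r) : h t.+1 - h t = (t == t1)%:R + (t == t2)%:R - 2 * (t == t3)%:R.
  have jmp (s : 'I_r) : (s < t.+1)%:R - (s < t)%:R = (t == s)%:R :> rat.
    by rewrite ltnS leq_eqVlt -val_eqE /= eq_sym; case: ltngtP.
  by rewrite -!jmp /h; ring.
have cut_jump (t : 'I_r) :
    \sum_(k | cut k) z k * (step t k)%:~R = - 2 * (t == t3)%:R.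
  have := zE t (ltn_ord t).
  have [i [j [ij ijs di dj]]] := root_vectorP (step_root (ltn_ord t)).
  rewrite jump [LHS in _ -> LHS = _]big_mkcond.
  rewrite !(sum_vsupp2 ij ijs) => [|k ->|k ->]; rewrite ?mulr0; last 2 first.
  - by case: (cut k).
  - by [].
  rewrite /cut.
  have [di1 dj1] : `|(step t i)%:~R : rat| = 1 /\ `|(step t j)%:~R : rat| = 1.
    by case: di dj => -> [] ->.
  have normM k : `|(step t k)%:~R : rat| = 1 -> `|z k| = `|z k * (step t k)%:~R|.
    by rewrite normrM => ->; rewrite mulr1.
  rewrite !normM //.
  (* On a step that is not half the prescribed jump is 0, so the two terms are opposite and are kept
     or cut together. On a half step the massless term is the whole jump, and only [t3] has a jump
     of absolute value 2. *)
  have [/existsP[k /andP[km dk]]|/negPf nhalf_t] := boolP (half t); last first.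
    have nt (s : 'I_r) : half s -> (t == s) = false.
      by move=> hs; apply/negP => /eqP ts; rewrite ts hs in nhalf_t.
    rewrite !nt // !mulr0n !mulr0 subr0 !addr0 => /eqP; rewrite addr_eq0 => /eqP ->.
    by rewrite normrN; case: ifP => _; ring.
  have small (x : rat) : x = (t == t1)%:R + (t == t2)%:R - 2 * (t == t3)%:R ->
      (if `|x| == 2 then x else 0) = - 2 * (t == t3)%:R.
    have [->|_] := eqVneq t t1; first by rewrite (negPf n12) eq_sym (negPf n31) => ->.
    have [->|_] := eqVneq t t2; first by rewrite (negPf n23) => ->.
    by case: eqVneq => _ ->.
  have : k \in [set i; j] by rewrite -ijs in_vsupp.
  have if0 : (if `|0 : rat| == 2 then 0 else 0) = 0 :> rat by case: (_ == _).
  case/set2P => kij; rewrite kij in km; rewrite (z0 _ km) mul0r if0.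
    by rewrite !add0r; apply: small.
  by rewrite !addr0; apply: small.
have : \sum_(t < r) \sum_(k | cut k) z k * (step t k)%:~R = - 2.
  under eq_bigr do rewrite cut_jump.
  rewrite (bigD1 t3) //= eqxx big1 ?addr0 // => t /negPf ->; exact: mulr0.
(* Summed along the path, each coordinate telescopes to the difference of the ends, which is 0 at
   massless indices, while [z] is 0 at massive ones. *)
rewrite exchange_big big1 //= => k ck.
rewrite -mulr_sumr -rmorph_sum sum_step.
have [/z0 ->|km] := boolP (k \in massive); first by rewrite mul0r.
by rewrite /diff (@massless_diff (u r) (u 0%N)) ?subrr ?mulr0 // (subsetP SP).
Qed.

(** The ends lie in the support and differ only at massive indices; there each half step contributes
    at most 1 and the other steps nothing. *)
Lemma endpoints_close : \sum_k `|diff (u r) (u 0%N) k| <= 2.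
Proof.
have -> : \sum_k `|diff (u r) (u 0%N) k| =
    \sum_(k in massive) `|diff (u r) (u 0%N) k|.
  rewrite [RHS]big_mkcond; apply: eq_bigr => k _; case: ifPn => // km.
  by rewrite /diff (@massless_diff (u r) (u 0%N)) ?subrr // (subsetP SP).
have le1 : \sum_(k in massive) `|diff (u r) (u 0%N) k| <=
    \sum_(t < r) (half t)%:R.
  apply: le_trans (ler_sum _ (fun t _ => massive_part_step (ltn_ord t))).
  rewrite exchange_big; apply: ler_sum => k _; rewrite -sum_step.
  exact: ler_norm_sum.
apply: le_trans le1 _; rewrite -natr_sum -big_mkcond sum1_card.
by have := card_half_le2; rewrite cardsE ler_nat.
Qed.

Lemma endpoints_even : exists c, \sum_k diff (u r) (u 0%N) k = c * 2.
Proof.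
under eq_bigr do rewrite -sum_step.
rewrite exchange_big; elim/big_ind: _ => [|_ _ [a ->] [b ->]|t _].
- by exists 0; rewrite mul0r.
- by exists (a + b); rewrite mulrDl.
have [i [j [ij ijs di dj]]] := root_vectorP (step_root (ltn_ord t)).
rewrite (sum_vsupp2 ij ijs) //; case: di dj => -> [] ->.
- by exists 1.
- by exists 0.
- by exists 0.
- by exists (-1).
Qed.

Lemma endpoints_adj : adj (u 0%N) (u r).
Proof.
have [|||//|[i [s [s2 ds]]]] := @root_or_double _ (diff (u r) (u 0%N)).
- exact: endpoints_close.
- exact: endpoints_even.
- case: (pickP (fun k => diff (u r) (u 0%N) k != 0)) => [k dk|d0]; first by exists k.
  case/negP: urS; rewrite (@p_inj (u r) (u 0%N)) // => k.
  by apply/eqP; rewrite -subr_eq0; have := d0 k => /negbFE.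
- by rewrite adj_sym.
by case: (no_double_sign _ _ s2 ds); rewrite ?uQ.
Qed.

End ShortestPath.

(** By induction on its length, a path in [Q] from [S] to a point of [supp] outside [S] may be
    assumed injective with interior outside the support. Its ends are then adjacent by
    [endpoints_adj]. *)
Lemma supp_connected : cut_connected adj Q -> cut_connected adj supp.
Proof.
move=> Qc S SP S0 SnP; case: (pselect (exists x y,
  [/\ x \in S, y \in supp, y \notin S & adj x y])) => // noedge; exfalso.
have [a aS] := set0Pn _ S0.
have [b bP bS] : exists2 b, b \in supp & b \notin S.
  by apply/subsetPn; apply: contra SnP => PS; rewrite eqEsubset SP.
have PQ := subsetP supp_sub.
have [r [u [u0 ur uQ uadj]]] :=
  cut_connected_path Qc (PQ a (subsetP SP a aS)) (PQ b bP).
rewrite -{a}u0 in aS; rewrite -{b}ur in bP bS.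
elim/ltn_ind: r u aS bP bS uQ uadj => r IH u u0S urP urS uQ uadj.
have r_gt1 : (1 < r)%N.
  case: r {IH uQ} urP urS uadj => [|[|//]]; first by rewrite u0S.
  by move=> uP uS uadj; case: noedge; exists (u 0%N), (u 1%N); rewrite u0S uadj.
case: noedge; exists (u 0%N), (u r); split=> //.
apply: (@endpoints_adj S) => // [t /andP[t0 tr]|].
  (* An interior point of the support shortens the path: keep the part after it if it lies in [S],
     the part before it otherwise. *)
  apply/negP => tP; have [tS|tS] := boolP (u t \in S).
    apply: (IH (r - t)%N _ (fun n => u (t + n)%N));
      rewrite ?addn0 ?subnKC ?(ltnW tr) //.
    - by rewrite ltn_subrL t0 (ltn_trans t0).
    - by move=> n; rewrite leq_subRL ?(ltnW tr) //; apply: uQ.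
    - by move=> n; rewrite ltn_subRL addnS; apply: uadj.
  by apply: (IH t _ u) => // n nt; [apply: uQ | apply: uadj];
    rewrite ?(leq_trans nt) ?(ltn_trans nt) ?(ltnW tr).
suff lt s t : (s < t)%N -> (t <= r)%N -> u s <> u t.
  move=> s t sr tr e; case: (ltngtP s t) => // l; first by case: (lt s t).
  by case: (lt t s).
move=> st tr est.
(* A repetition [u s = u t] is removed by excising the loop between [s] and [t]; when [t = r] the
   new path ends at [s]. *)
apply: (IH (r - (t - s))%N _ (fun n => if (n <= s)%N then u n else u (n + (t - s))%N)).
- by lia.
- by rewrite leq0n.
- case: ifP => h; last by have -> : (r - (t - s) + (t - s) = r)%N by lia.
  have -> : (r - (t - s) = s)%N by lia.
  by rewrite est (_ : t = r) //; lia.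
- case: ifP => h; last by have -> : (r - (t - s) + (t - s) = r)%N by lia.
  have -> : (r - (t - s) = s)%N by lia.
  by rewrite est (_ : t = r) //; lia.
- by move=> n nr; case: ifP => h; apply: uQ; lia.
move=> n nr; case: (ltngtP n s) => ns.
- by apply: uadj; lia.
- by rewrite addSn; apply: uadj; lia.
by rewrite ns est addSn subnKC ?(ltnW st) //; apply: uadj; lia.
Qed.

(** * Index pairs of the edges of the support *)

Section Massive.
Hypothesis supp_conn : cut_connected adj supp.

Definition ix x y := vsupp (diff x y).

Lemma ix_sym x y : ix x y = ix y x.
Proof. by apply/setP => k; rewrite !inE /diff -oppr_eq0 opprB. Qed.

Lemma ix_massive x y : x \in supp -> y \in supp -> ix x y \subset massive.
Proof.
move=> xS yS; apply/subsetP => k; rewrite in_vsupp; apply: contraR => km.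
by rewrite /diff (massless_diff xS yS km) subrr.
Qed.

Lemma massive_mass k x y : x \in supp -> y \in supp -> k \in ix x y -> mass k != 0.
Proof. by move=> xS yS /(subsetP (ix_massive xS yS)); rewrite inE. Qed.

(** By [massive_lt_supp] the support has at least two more points than [I] has indices. *)
Lemma supp_fresh (I : {set K}) (F : {set T}) x y : x \in supp -> y \in supp ->
  I \subset massive -> (#|F| < #|I| + 2)%N -> exists2 z, z \in supp & z \notin F.
Proof.
move=> xS yS /subset_leq_card Im Flt; apply/subsetPn; apply/negP => /subset_leq_card.
have := massive_lt_supp; lia.
Qed.

(** The form takes the value [1 / w b], which is nonzero, so some term of its sum is nonzero. *)
Lemma adjacent_ix_meet a b c : a \in supp -> b \in supp -> c \in supp ->
  a != b -> c != a -> c != b -> exists2 k, k \in ix a b & k \in ix c b.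
Proof.
move=> aS bS cS ab ca cb; have /eqP := mform_adjacent aS bS cS ab ca cb.
case: (pickP [pred k | (k \in ix a b) && (k \in ix c b)]) => [k /andP[]|no].
  by exists k.
rewrite /mform big1 => [|k _].
  by rewrite eq_sym invr_eq0 => wb; rewrite inE wb in bS.
have /negbT := no k; rewrite /= !in_vsupp negb_and !negbK.
by case/orP => /eqP ->; rewrite ?mulr0 ?mul0r.
Qed.

Lemma mform2 a b i j v : i != j -> ix a b = [set i; j] ->
  mform (diff a b) v = (diff a b i)%:~R * (v i)%:~R / mass i
                     + (diff a b j)%:~R * (v j)%:~R / mass j.
Proof.
by move=> ij abij; rewrite /mform (sum_vsupp2 ij abij) // => k ->; rewrite !mul0r.
Qed.

(** Disjoint edges are orthogonal, whereas a single common index would leave a single nonzero term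
    in the form. *)
Lemma disjoint_ix_eq a b c d k :
  a \in supp -> b \in supp -> c \in supp -> d \in supp ->
  c != a -> c != b -> d != a -> d != b -> adj a b -> adj c d ->
  k \in ix a b -> k \in ix c d -> ix a b = ix c d.
Proof.
move=> aS bS cS dS ca cb da db ab cd kab kcd.
have := mform_disjoint aS bS cS dS ca cb da db.
have mk := massive_mass aS bS kab.
have [i [ki abE dk di]] := root_at ab kab; rewrite (mform2 _ ki) // => E.
have [icd|] := boolP (i \in ix c d).
  by rewrite /ix abE (root_vsupp2 cd ki kcd icd).
rewrite in_vsupp negbK => /eqP ci; move: kcd; rewrite in_vsupp.
move: E; rewrite ci mulr0 mul0r addr0 => /eqP.
by rewrite !mulf_eq0 invr_eq0 (negPf mk) orbF !intr_eq0; case: dk => -> /= => ->.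
Qed.

(** Compare the signs of [a - b] and [c - b] at the two indices. Two agreements give [a = c] and
    exactly one makes [a - c] a double. With none, [a - b = -(c - b)], and pairing with [x - b] for
    a further point [x] gives [1 / w b = - 1 / w b]. *)
Lemma adjacent_not_parallel a b c : a \in supp -> b \in supp -> c \in supp ->
  a != c -> adj a b -> adj c b -> ix a b = ix c b -> False.
Proof.
move=> aS bS cS ac ab cb abcb.
have [i [j [ij abE ai aj]]] := root_vectorP ab.
have cbE : vsupp (diff c b) = [set i; j] by rewrite -abE -/(ix a b) abcb.
have [ci cj] : (diff c b i = 1 \/ diff c b i = -1) /\
               (diff c b j = 1 \/ diff c b j = -1).
  have h k : k \in [set i; j] -> diff c b k = 1 \/ diff c b k = -1.
    by rewrite -cbE => /(root_at cb)[l []].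
  by split; apply: h; rewrite ?set21 ?set22.
have zero k : k \notin [set i; j] -> diff a b k = 0 /\ diff c b k = 0.
  move=> kij; have := kij; rewrite -{1}abE in_vsupp negbK => /eqP ->.
  by move: kij; rewrite -cbE in_vsupp negbK => /eqP ->.
have QP := subsetP supp_sub.
have acE k : diff a c k = diff a b k - diff c b k by rewrite /diff; ring.
have double l l' : l != l' -> [set i; j] = [set l; l'] ->
    diff a b l' = diff c b l' -> diff a b l = 1 \/ diff a b l = -1 ->
    diff c b l = - diff a b l -> False.
  move=> ll' ijl el' al el.
  apply: (@no_double_sign a c l (diff a b l * 2)); rewrite ?QP //.
    by case: al => ->; [left | right].
  move=> k; rewrite acE; have [->|kl] := eqVneq k l; first by rewrite el; ring.
  have [->|kl'] := eqVneq k l'; first by rewrite el' subrr.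
  by have [|-> ->] := zero k; rewrite ?subrr // ijl !inE negb_or kl.
have pm (x y : int) : x = 1 \/ x = -1 -> y = 1 \/ y = -1 -> x = y \/ y = - x by lia.
case: (pm _ _ ai ci) (pm _ _ aj cj) => ei [] ej.
- case/eqP: ac; apply: p_inj => k; apply/eqP; rewrite -subr_eq0 -/(diff a c k) acE.
  have [/set2P[]->|/zero[-> ->]] := boolP (k \in [set i; j]);
    by rewrite ?ei ?ej subrr.
- by apply: (double j i); rewrite // 1?eq_sym // setUC.
- exact: (double i j).
(* Two massive indices force at least four points in the support. *)
have [|x xS] := supp_fresh aS bS (ix_massive aS bS) (F := [set a; b; c]).
  rewrite /ix abE cards2 ij -setUA !cardsU1 cards1.
  by case: (a \notin _); case: (b \notin _).
rewrite !inE !negb_or => /andP[/andP[xa xb] xc].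
have /suppP/eqP wb := bS; case/eqP: wb; apply: invr_inj; rewrite invr0.
have := mform_adjacent aS bS xS (adj_neq ab) xa xb.
have := mform_adjacent cS bS xS (adj_neq cb) xc xb.
rewrite !(mform2 _ ij) // ei ej; move: (diff x b) => v.
by rewrite !rmorphN /= => <- /eqP E; lra.
Qed.

(** Orthogonality of [a - b] and [c - d] makes the masses at [i] and [j] equal up to sign. For a
    fresh [z], both [z - y], orthogonal to [a - b], and [z - b], orthogonal to [c - d], then have
    entries of equal absolute value at [i] and [j]; but they differ by [y - b], which is [+-1] at
    [i] and 0 at [j]. *)
Lemma disjoint_not_parallel_step a b c d y :
  a \in supp -> b \in supp -> c \in supp -> d \in supp ->
  c != a -> c != b -> d != a -> d != b -> adj a b -> adj c d ->
  y \in supp -> y != a -> adj y b -> ix a b = ix c d -> False.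
Proof.
move=> aS bS cS dS ca cb da db ab cd yS ya yb abcd.
have [i iab iyb] := adjacent_ix_meet aS bS yS (adj_neq ab) ya (adj_neq yb).
have [j [ij abE ai aj]] := root_at ab iab.
have [k [ik ybE yi yk]] := root_at yb iyb.
have nybab : ix a b <> ix y b.
  by apply: (adjacent_not_parallel aS bS yS); rewrite // eq_sym.
have jk : j != k.
  by apply/eqP => jk; case: nybab; rewrite /ix abE ybE jk.
have ycd : (y == c) || (y == d).
  apply/negPn/negP; rewrite negb_or => /andP[yc yd]; case: nybab; rewrite abcd.
  apply: (@disjoint_ix_eq c d y b i) => //; rewrite 1?eq_sym //.
  by rewrite -abcd.
(* The three distinct massive indices [i], [j], [k] force at least five points. *)
have [z zS] : exists2 z, z \in supp & z \notin [set a; b; c; d].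
  apply: (supp_fresh aS bS (I := k |: ix a b)).
    rewrite subUset (ix_massive aS bS) andbT sub1set.
    by rewrite (subsetP (ix_massive yS bS)) // /ix ybE set22.
  have F4 : (#|[set a; b; c; d]| <= 4)%N.
    rewrite -!setUA !cardsU1 cards1.
    by case: (a \notin _); case: (b \notin _); case: (c \notin _).
  rewrite cardsU1 /ix abE cards2 ij !inE (eq_sym k i) (eq_sym k j).
  by rewrite (negPf ik) (negPf jk).
rewrite !inE !negb_or => /andP[/andP[/andP[za zb] zc] zd].
have cdE : ix c d = [set i; j] by rewrite -abcd.
have mi := massive_mass aS bS iab.
have mj : mass j != 0 by apply: (massive_mass aS bS); rewrite /ix abE set22.
have [ci cj] : (diff c d i = 1 \/ diff c d i = -1) /\
               (diff c d j = 1 \/ diff c d j = -1).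
  have h l : l \in [set i; j] -> diff c d l = 1 \/ diff c d l = -1.
    by rewrite -cdE => /(root_at cd)[l' []].
  by split; apply: h; rewrite ?set21 ?set22.
have := mform_disjoint aS bS cS dS ca cb da db; rewrite (mform2 _ ij) // => abcd0.
have [s s1 mE] : exists2 s : rat, s = 1 \/ s = -1 & mass j = s * mass i.
  exact: opposite_masses mi mj ai aj ci cj abcd0.
have yb_b : y != b := adj_neq yb.
have u_pm : diff z y i = diff z y j \/ diff z y i = - diff z y j.
  apply: (pm_of_weighted mi mE s1 ai aj); rewrite -mform2 //.
  exact: mform_disjoint.
have v_pm : diff z b i = diff z b j \/ diff z b i = - diff z b j.
  apply: (pm_of_weighted mi mE s1 ci cj); rewrite -mform2 //.
  by apply: mform_disjoint; rewrite // eq_sym.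
have yj : diff y b j = 0.
  apply/eqP; rewrite -[_ == 0]negbK -in_vsupp ybE !inE negb_or.
  by rewrite (eq_sym j i) ij jk.
have yi1 : diff z b i = diff z y i + diff y b i by rewrite /diff; ring.
have yj1 : diff z b j = diff z y j + diff y b j by rewrite /diff; ring.
(* The contradiction is one of parity: adding [+-1] to one entry only cannot preserve equality up to
   sign. *)
move: u_pm v_pm yi; rewrite yi1 yj1 yj addr0.
move: (diff z y i) (diff z y j) (diff y b i) => u u' v.
clear; lia.
Qed.

(** A common index makes the two edges parallel. Connectedness gives an edge leaving [{a, b}], to
    which the previous lemma applies after possibly exchanging [a] and [b]. *)
Lemma disjoint_ix a b c d k :
  a \in supp -> b \in supp -> c \in supp -> d \in supp ->
  c != a -> c != b -> d != a -> d != b -> adj a b -> adj c d ->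
  k \in ix a b -> k \notin ix c d.
Proof.
move=> aS bS cS dS ca cb da db ab cd kab; apply/negP => kcd.
have abcd := disjoint_ix_eq aS bS cS dS ca cb da db ab cd kab kcd.
have abS : [set a; b] \subset supp by rewrite subUset !sub1set aS.
have [||x [y [/set2P xab yS yab xy]]] := supp_conn abS.
- by apply/set0Pn; exists a; rewrite set21.
- by apply/eqP => abE; move: cS; rewrite -abE !inE (negPf ca) (negPf cb).
move: yab; rewrite !inE negb_or => /andP[ya yb].
case: xab => xE; subst x; rewrite adj_sym in xy.
  apply: (@disjoint_not_parallel_step b a c d y) => //; first by rewrite adj_sym.
  by rewrite ix_sym.
exact: (@disjoint_not_parallel_step a b c d y).
Qed.

(** The edge from [a] to [g] must share [x] or [y] with the edge from [a] to [b], yet it is disjoint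
    from the edges at [b] carrying [x] and [y]. *)
Lemma triangle_star_leaf a b c d x y g :
  a \in supp -> b \in supp -> c \in supp -> d \in supp ->
  adj a b -> adj c b -> adj d b -> ix a b = [set x; y] -> x \in ix c b ->
  y \in ix d b -> a != c -> a != d -> g \in supp ->
  g != b -> g != c -> g != d -> adj a g -> False.
Proof.
move=> aS bS cS dS ab cb db abE xcb ydb ac ad gS gb gc gd ag.
have ba : adj b a by rewrite adj_sym.
have ga : adj g a by rewrite adj_sym.
have bg : b != g by rewrite eq_sym.
have [k kga kba] := adjacent_ix_meet gS aS bS (adj_neq ga) bg (adj_neq ba).
rewrite ix_sym abE in kba.
have leaf e : e \in supp -> adj e b -> a != e -> g != e -> k \notin ix e b.
  move=> eS eb ae ge; apply: (@disjoint_ix g a e b k) => //; rewrite 1?eq_sym //.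
  exact: adj_neq.
case/set2P: kba => kE; subst k.
  by move: (leaf c cS cb ac gc); rewrite xcb.
by move: (leaf d dS db ad gd); rewrite ydb.
Qed.

(** Three massive indices force a fifth point, so some edge leaves the star. It cannot start at a
    leaf. Starting at [b], it would meet each of the pairs [xy], [xu], [yu], hence contain one of
    them and be parallel to that edge. *)
Lemma no_triangle_star a b c d x y u :
  a \in supp -> b \in supp -> c \in supp -> d \in supp ->
  adj a b -> adj c b -> adj d b -> x != y -> x != u -> y != u ->
  ix a b = [set x; y] -> ix c b = [set x; u] -> ix d b = [set y; u] -> False.
Proof.
move=> aS bS cS dS ab cb db xy xu yu abE cbE dbE.
have set2_neq (i j k : K) : i != k -> j != k -> i != j -> [set i; k] != [set j; k].
  move=> ik jk ij; apply/eqP => /setP/(_ i).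
  by rewrite !inE eqxx (negPf ij) (negPf ik).
have yx : y != x by rewrite eq_sym.
have ux : u != x by rewrite eq_sym.
have uy : u != y by rewrite eq_sym.
have ac : a != c.
  apply: contra (set2_neq y u x yx ux yu) => /eqP ace.
  by rewrite !(setUC _ [set x]) -cbE -abE ace.
have ad : a != d.
  apply: contra (set2_neq x u y xy uy xu) => /eqP ade.
  by rewrite (setUC [set u]) -dbE -abE ade.
have cd : c != d.
  by apply: contra (set2_neq x y u xu yu xy) => /eqP cde; rewrite -cbE -dbE cde.
have card3 : (#|u |: ix a b| = 3)%N.
  by rewrite cardsU1 abE cards2 xy !inE (eq_sym u x) (eq_sym u y) (negPf xu) (negPf yu).
have Im : u |: ix a b \subset massive.
  rewrite subUset (ix_massive aS bS) andbT sub1set.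
  by rewrite (subsetP (ix_massive cS bS)) // cbE set22.
have F4 : (#|[set a; b; c; d]| <= 4)%N.
  rewrite -!setUA !cardsU1 cards1.
  by case: (a \notin _); case: (b \notin _); case: (c \notin _).
have [|||f [g [fF gS gF fg]]] := supp_conn (S := [set a; b; c; d]).
- by rewrite !subUset !sub1set aS bS cS.
- by apply/set0Pn; exists a; rewrite !inE eqxx.
- apply/eqP => FE; have [|z zS] := supp_fresh aS bS Im (F := [set a; b; c; d]).
    by rewrite card3.
  by rewrite FE zS.
move: gF; rewrite !inE !negb_or => /andP[/andP[/andP[ga gb] gc] gd].
have xcb : x \in ix c b by rewrite cbE set21.
have xab : x \in ix a b by rewrite abE set21.
have yab : y \in ix a b by rewrite abE set22.
have ydb : y \in ix d b by rewrite dbE set21.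
have ucb : u \in ix c b by rewrite cbE set22.
have udb : u \in ix d b by rewrite dbE set22.
move: fF; rewrite !inE => /orP[/orP[/orP[]|]|] /eqP fE; subst f.
- exact: (@triangle_star_leaf a b c d x y g).
- have gb' : adj g b by rewrite adj_sym.
  have np e : e \in supp -> adj e b -> g != e -> ix e b <> ix g b.
    by move=> eS eb ge; apply: adjacent_not_parallel; rewrite // eq_sym.
  have hit e : e \in supp -> adj e b -> g != e ->
      exists2 k, k \in ix e b & k \in ix g b.
    by move=> eS eb ge; apply: adjacent_ix_meet; rewrite // adj_neq.
  have two k l : k != l -> k \in ix g b -> l \in ix g b -> ix g b = [set k; l].
    by move=> kl; apply: root_vsupp2.
  have [k1] := hit a aS ab ga; have [k2] := hit c cS cb gc; have [k3] := hit d dS db gd.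
  have nab := np a aS ab ga; have ncb := np c cS cb gc; have ndb := np d dS db gd.
  rewrite abE cbE dbE in nab ncb ndb *.
  have nxy : ~ (x \in ix g b /\ y \in ix g b).
    by case=> h h'; apply: nab; rewrite (two x y).
  have nxu : ~ (x \in ix g b /\ u \in ix g b).
    by case=> h h'; apply: ncb; rewrite (two x u).
  have nyu : ~ (y \in ix g b /\ u \in ix g b).
    by case=> h h'; apply: ndb; rewrite (two y u).
  by case/set2P => -> h3 /set2P[] -> h2 /set2P[] -> h1; tauto.
- apply: (@triangle_star_leaf c b a d x u g) => //; by rewrite eq_sym.
apply: (@triangle_star_leaf d b a c y u g) => //; by rewrite eq_sym.
Qed.

Definition idx (R : {set T}) :=
  [set k | [exists a in R, exists b in R, adj a b && (k \in ix a b)]].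

Lemma idxP (R : {set T}) k : reflect
  (exists a b, [/\ a \in R, b \in R, adj a b & k \in ix a b]) (k \in idx R).
Proof.
rewrite inE.
apply: (iffP existsP) => [[a /andP[aR /existsP[b]]]|[a [b [aR bR ab kab]]]].
  by case/and3P => bR ab kab; exists a, b.
by exists a; rewrite aR /=; apply/existsP; exists b; rewrite bR ab.
Qed.

Lemma idxS (R R' : {set T}) : R \subset R' -> idx R \subset idx R'.
Proof.
move=> /subsetP RR; apply/subsetP => k /idxP[a [b [aR bR ab kab]]].
by apply/idxP; exists a, b; rewrite !RR.
Qed.

(* A maximal [R] with at least as many indices as points must be all of [supp],
   which has too many points: a neighbour of [R] bringing no new index would
   complete a triangle star. *)
Lemma connected_supp_absurd : False.
Proof.
have [a aS] : exists a, a \in supp.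
  by case: Qw => _ [a wa] _; exists a; rewrite inE.
have [|||b [c [bS cS cb bc]]] := supp_conn (S := [set a]).
- by rewrite sub1set.
- by apply/set0Pn; exists a; rewrite set11.
- by apply: contraTneq massive_lt_supp => <-; rewrite cards1; lia.
move/set1P: bS => bE; subst b; rewrite inE in cb; rename cb into ca; rename bc into ac.
pose good (R : {set T}) := [&& R \subset supp, 1 < #|R| & #|R| <= #|idx R|]%N.
have [|R] := @maxset_exists _ good [set a; c].
  rewrite /good subUset !sub1set aS cS cards2 eq_sym ca /=.
  have [i [j [ij acE _ _]]] := root_vectorP ac.
  apply: (@leq_trans #|ix a c|); first by rewrite /ix acE cards2 ij.
  apply/subset_leq_card/subsetP => k kac; apply/idxP.
  by exists a, c; rewrite set21 set22.
move=> /maxsetP[/and3P[RS R1 Ridx] Rmax] _.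
have [||b [a' [bR a'S a'R ba]]] := supp_conn RS.
- by apply/set0Pn/card_gt0P; rewrite ltnW.
- apply: contraTneq massive_lt_supp => RE; rewrite -ltnNge -RE.
  apply: leq_ltn_trans Ridx _; rewrite addn2 ltnS ltnW // ltnS.
  apply/subset_leq_card/subsetP => k /idxP[x [y [xR yR _ kxy]]].
  by apply: (subsetP (@ix_massive x y _ _)); rewrite ?(subsetP RS).
have RSP := subsetP RS; have bS := RSP b bR.
have ab : adj a' b by rewrite adj_sym.
have old k : k \in ix a' b -> k \in idx R.
  move=> kab; apply/negPn/negP => kR; move/negP: (a'R); apply.
  suff /Rmax <- : good (a' |: R); rewrite ?setU11 ?subsetUr //.
  rewrite /good subUset sub1set a'S RS cardsU1 a'R add1n ltnS ltnW //=.
  apply: leq_trans (subset_leq_card (_ : k |: idx R \subset _)).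
    by rewrite cardsU1 kR.
  rewrite subUset idxS ?subsetUr // andbT sub1set; apply/idxP.
  by exists a', b; rewrite setU11 setU1r.
(* An edge inside [R] carrying [k] must end at [b], since otherwise it is disjoint from the edge
   from [a'] to [b]. *)
have at_b k : k \in ix a' b -> exists e, [/\ e \in R, adj e b & k \in ix e b].
  move=> kab; have /idxP[e [f [eR fR ef kef]]] := old k kab.
  have [eb|eb] := eqVneq e b.
    by exists f; rewrite adj_sym -eb ef ix_sym.
  have [fb|fb] := eqVneq f b; first by exists e; rewrite -fb.
  have na g : g \in R -> g != a' by move=> gR; apply: contraNneq a'R => <-.
  have := disjoint_ix a'S bS (RSP e eR) (RSP f fR) (na e eR) eb (na f fR) fb ab.
  by move=> /(_ _ ef kab); rewrite kef.
have [x [y [xy abE _ _]]] := root_vectorP ab.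
have xab : x \in ix a' b by rewrite /ix abE set21.
have yab : y \in ix a' b by rewrite /ix abE set22.
have [c' [cR cb' xcb]] := at_b x xab; have [d [dR db ydb]] := at_b y yab.
have na g : g \in R -> a' != g by move=> gR; apply: contraNneq a'R => ->.
have np e : e \in R -> adj e b -> ix a' b <> ix e b.
  by move=> eR eb; apply: adjacent_not_parallel (RSP e eR) (na e eR) ab eb.
have [u [xu cbE _ _]] := root_at cb' xcb; have [v [yv dbE _ _]] := root_at db ydb.
have uy : u != y.
  by apply: contra_notN (np c' cR cb') => /eqP uy; rewrite /ix abE cbE uy.
have vx : v != x.
  by apply: contra_notN (np d dR db) => /eqP vx; rewrite /ix abE dbE vx setUC.
have cd : c' != d.
  apply: contra_notN (np d dR db) => /eqP ce.
  by rewrite /ix abE (root_vsupp2 db xy) // -?ce.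
have dc : d != c' by rewrite eq_sym.
(* The edges from [b] to [c'] and [d] have the pairs [{x, u}] and [{y, v}]; they must meet, and only
   [u = v] is possible, which closes the triangle star. *)
have [k] := adjacent_ix_meet (RSP c' cR) bS (RSP d dR) (adj_neq cb') dc (adj_neq db).
rewrite /ix cbE dbE => /set2P[] -> /set2P[] uv.
- by rewrite uv eqxx in xy.
- by rewrite uv eqxx in vx.
- by rewrite uv eqxx in uy.
apply: (no_triangle_star a'S bS (RSP c' cR) (RSP d dR) ab cb' db xy xu _ abE cbE).
  by rewrite eq_sym.
by rewrite uv; exact: dbE.
Qed.

End Massive.
End Circuit.

Theorem exists_double_difference (T K : finType) (p : T -> K -> int) :
    (forall x y, (forall k, p x k = p y k) -> x = y) ->
    cut_connected (adj p) setT ->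
    (exists2 v, affine_relation p setT v & exists x, v x != 0) ->
    (forall w, affine_relation p setT w -> forall i j, i != j ->
       \sum_x w x * (p x i)%:~R * (p x j)%:~R = 0) ->
  exists x y i, forall k, diff p x y k = if k == i then 2 else 0.
Proof.
move=> p_inj Tc [v relv v0] diag.
have [Q [w [Qc Qw]]] := connected_circuit_space (adj_sym p) Tc relv v0.
case: (pselect (exists x y i, forall k, diff p x y k = if k == i then 2 else 0)).
  by [].
move=> nodbl; exfalso.
have w_diag : forall i j, i != j -> \sum_x w x * (p x i)%:~R * (p x j)%:~R = 0.
  by apply: diag; have [[_ w1 w2] _ _] := Qw; split=> // x; rewrite inE.
have no_double x y i : x \in Q -> y \in Q ->
    ~ (forall k, diff p x y k = if k == i then 2 else 0).
  by move=> _ _ d; apply: nodbl; exists x, y, i.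
apply: (connected_supp_absurd p_inj Qw w_diag no_double).
exact: (supp_connected p_inj Qw w_diag no_double Qc).
Qed.

(** * The points [p(g)] attached to group elements *)

Section SignedCoordinates.
Variable m : nat.
Implicit Types g h l : G2 m.

Definition scoord g (k : 'I_m) : int := sgn g * vec g 0 k.

Lemma sum_scoord g : \sum_k scoord g k = 1 - sgn g.
Proof.
have -> : \sum_k scoord g k = sgn g * Defs.eta (vec g) by rewrite /Defs.eta mulr_sumr.
by rewrite eta_vec mulrBr G2_sgnK mulr1.
Qed.

(** The coordinate sum [1 - sgn g] recovers the sign. *)
Lemma scoord_inj g h : (forall k, scoord g k = scoord h k) -> g = h.
Proof.
move=> gh; have sE : sgn g = sgn h.
  have := sum_scoord g; rewrite (eq_bigr _ (fun k _ => gh k)) sum_scoord.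
  by move/addrI/oppr_inj.
apply: val_inj; rewrite [val g]surjective_pairing [val h]surjective_pairing.
congr (_, _) => //; apply/rowP => k; have := gh k; rewrite /scoord sE.
by case: (sgn_cases h) => ->; rewrite ?mul1r // !mulN1r => /oppr_inj.
Qed.

Lemma scoord_mul l g k : scoord (l * g)%g k = sgn g * scoord l k + scoord g k.
Proof.
have vE : vec (l * g)%g = vec l + sgn l *: vec g by [].
have sE : sgn (l * g)%g = sgn l * sgn g by [].
rewrite /scoord vE sE !mxE mulrDr; congr (_ + _); first by ring.
by rewrite mulrACA G2_sgnK mul1r.
Qed.

Lemma gens_sqr l : l \in gens -> \sum_k vec l 0 k ^+ 2 = 2.
Proof.
rewrite inE => /existsP[i /existsP[j /andP[ij lE]]].
have vE k : vec l 0 k ^+ 2 = (k == i)%:R + (k == j)%:R.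
  rewrite /vec; case/orP: lE => /eqP -> /=; rewrite !mxE /=.
    by have [->|_] := eqVneq k i; [rewrite (negPf ij) | case: eqP].
  by have [->|_] := eqVneq k i; [rewrite (negPf ij) | case: eqP].
under eq_bigr do rewrite vE.
have one (a : 'I_m) : \sum_k (k == a)%:R = 1 :> int.
  by rewrite (bigD1 a) //= eqxx big1 ?addr0 // => k /negPf ->.
by rewrite big_split /= !one.
Qed.

Lemma cayley_root g h : cayley g h -> root_vector (fun k => scoord h k - scoord g k).
Proof.
move=> /gens_sqr gh; rewrite /root_vector -gh; apply/eqP/eq_bigr => k _.
have {1}-> : h = (h * g^-1 * g)%g by rewrite -mulgA mulVg mulg1.
rewrite scoord_mul addrK exprMn expr2 G2_sgnK mul1r.
by rewrite /scoord exprMn expr2 G2_sgnK mul1r.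
Qed.

End SignedCoordinates.

(** * Translating degeneracy and resonance *)

Section CombinatorialGraph.
Variables (m : nat) (A : {fset G2 m}).

Let p (x : A) (k : 'I_m) := scoord (val x) k.

Lemma comb_graph_cut_connected : comb_graph A -> cut_connected (adj p) setT.
Proof.
move=> [_ Ac] S _ /set0Pn[a aS] ST.
case: (pselect (exists x y, [/\ x \in S, y \in setT, y \notin S & adj p x y])) => // no.
case/eqP: ST; apply/setP => b; rewrite inE.
have [s sp ->] := connectP (Ac a b).
elim: s a aS sp => //= c s IH a aS /andP[ac]; apply: IH.
apply/negPn/negP => cS; apply: no; exists a, c; rewrite inE; split=> //.
by rewrite adj_sym; exact: cayley_root.
Qed.

Lemma big_fset_nth (R : nmodType) (f : G2 m -> R) :
  \sum_(x : A) f (val x) = \sum_(i < size A) f (nth 1%g A i).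
Proof. by rewrite -(big_seq_fsetE _ A xpredT f) (big_nth 1%g) big_mkord. Qed.

(** Adjoining the column of signs raises the rank by at most one, so the rank stays below the number
    of vertices and a nonzero row [u] kills both blocks. Multiplying [u] by the signs turns this
    into an affine relation among the points. *)
Lemma degenerate_relation : 1%g \in A -> degenerate A ->
  exists2 v, affine_relation p setT v & exists x, v x != 0.
Proof.
move=> A1; rewrite /degenerate /grank; set V := \matrix_k _ => Vdeg.
pose s : 'cV[rat]_(size A) := \col_k (sgn (nth 1%g A k))%:~R.
pose W := row_mx V s.
have : kermx W != 0.
  rewrite kermx_eq0 /row_free; apply: contraTneq Vdeg => WE; rewrite -leqNgt.
  have := cardfsD1 1%g A; rewrite A1 add1n => AE.
  rewrite -ltnS -AE -[X in (X <= _)%N]WE -mxrank_tr tr_row_mx -addsmxE.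
  rewrite (leq_trans (mxrank_adds_leqif _ _)) // !mxrank_tr.
  by rewrite -[X in (_ <= X)%N]addn1 leq_add2l rank_leq_col.
case/rowV0Pn => u /sub_kermxP; rewrite mul_mx_row => uW u0.
have [uV us] : u *m V = 0 /\ u *m s = 0.
  by move: uW; rewrite -[0 in RHS]row_mx0 => /eq_row_mx.
pose c h := if insub (index h A) is Some i then u 0 i else 0.
have cE (i : 'I_(size A)) : c (nth 1%g A i) = u 0 i.
  by rewrite /c index_uniq ?fset_uniq // valK.
have sK (h : G2 m) : (sgn h)%:~R * (sgn h)%:~R = 1 :> rat.
  by rewrite -rmorphM /= G2_sgnK.
exists (fun x => c (val x) * (sgn (val x))%:~R).
  split=> [x | | k]; first by rewrite inE.
    rewrite (big_fset_nth (fun h => c h * (sgn h)%:~R)).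
    have /matrixP/(_ 0 0) := us; rewrite !mxE => E; rewrite -[RHS]E.
    by apply: eq_bigr => i _; rewrite mxE cE.
  rewrite (big_fset_nth (fun h => c h * (sgn h)%:~R * (scoord h k)%:~R)).
  have /matrixP/(_ 0 k) := uV; rewrite !mxE => E; rewrite -[RHS]E.
  apply: eq_bigr => i _; rewrite cE /V /ratvec !mxE /scoord rmorphM /=.
  by rewrite mulrA -(mulrA (u 0 i)) sK mulr1.
have [i ui] : exists i, u 0 i != 0.
  case: (pickP (fun i => u 0 i != 0)) => [i ui|u00]; first by exists i.
  case/eqP: u0; apply/rowP => i; rewrite mxE; apply/eqP/negbFE; exact: u00.
have iA : nth 1%g A i \in A by rewrite mem_nth.
exists [` iA]%fset; rewrite /= cE mulf_neq0 // intr_eq0.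
by case: (sgn_cases (nth 1%g A i)) => ->.
Qed.

Lemma meval_C (t : 'I_m -> rat) h : (C_ h : {mpoly rat[m]}).@[t] =
  (sgn h)%:~R / 2 * ((\sum_k t k * (vec h 0 k)%:~R) ^+ 2
    + \sum_k t k ^+ 2 * (vec h 0 k)%:~R).
Proof.
rewrite /C_ mevalZ mevalD rmorphXn /= !raddf_sum /=; congr (_ * (_ ^+ 2 + _)).
  by apply: eq_bigr => k _; rewrite raddfMz /= mevalXU mulrzr.
by apply: eq_bigr => k _; rewrite raddfMz /= rmorphXn /= mevalXU mulrzr.
Qed.

(* Polarization extracts the coefficient of [t_i t_j]. *)
Lemma meval_C_polar (h : G2 m) (i j : 'I_m) : i != j ->
  (C_ h).@[fun k : 'I_m => (k == i)%:R + (k == j)%:R]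
    - (C_ h).@[fun k : 'I_m => (k == i)%:R]
    - (C_ h).@[fun k : 'I_m => (k == j)%:R]
  = (sgn h)%:~R * (vec h 0 i)%:~R * (vec h 0 j)%:~R :> rat.
Proof.
move=> ij; rewrite !meval_C.
have pick (a : 'I_m) (f : 'I_m -> rat) : \sum_k (k == a)%:R * f k = f a.
  rewrite (bigD1 a) //= eqxx mul1r big1 ?addr0 // => k /negPf ->; exact: mul0r.
have sq (a : 'I_m) (f : 'I_m -> rat) : \sum_k (k == a)%:R ^+ 2 * f k = f a.
  by rewrite -[RHS]pick; apply: eq_bigr => k _; case: (k == a).
have -> : \sum_k ((k == i)%:R + (k == j)%:R) ^+ 2 * (vec h 0 k)%:~R =
    (vec h 0 i)%:~R + (vec h 0 j)%:~R :> rat.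
  rewrite -(pick i (fun k => (vec h 0 k)%:~R)) -(pick j (fun k => (vec h 0 k)%:~R)).
  rewrite -big_split /=.
  apply: eq_bigr => k _; rewrite -mulrDl; congr (_ * _).
  by have [->|] := eqVneq k i; [rewrite (negPf ij) | case: (k == j)].
have -> : \sum_k ((k == i)%:R + (k == j)%:R) * (vec h 0 k)%:~R =
    (vec h 0 i)%:~R + (vec h 0 j)%:~R :> rat.
  rewrite -(pick i (fun k => (vec h 0 k)%:~R)) -(pick j (fun k => (vec h 0 k)%:~R)).
  rewrite -big_split /=.
  by apply: eq_bigr => k _; rewrite mulrDl.
by rewrite !pick !sq; field.
Qed.

(** After clearing denominators, [v] times the signs is an integer relation among the vertices.
    Resonance applies to it, and the coefficient of [t_i t_j] is the required sum up to the factor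
    [d]. *)
Lemma resonant_diag v : 1%g \in A -> resonant A -> affine_relation p setT v ->
  forall i j, i != j -> \sum_x v x * (p x i)%:~R * (p x j)%:~R = 0.
Proof.
move=> A1 resA [_ v1 v2] i j ij.
have [d d0 [n nE]] : exists2 d : int, d != 0 & exists n : G2 m -> int,
    forall x : A, (n (val x))%:~R = d%:~R * v x.
  have [d d0 [n nE]] := clear_denom (fun i : 'I_#|{: A}| => v (enum_val i)).
  exists d => //; exists (fun h => if insub h is Some x then n (enum_rank x) else 0).
  by move=> x; rewrite valK nE enum_rankK.
pose N h := n h * sgn h.
(* The identity contributes 0 to both the relation and the resonance sum, so these can be taken over
   all of [A]. *)
have drop1 (R : nmodType) (f : G2 m -> R) : f 1%g = 0 ->
    \sum_(h <- (A `\ 1%g)%fset) f h = \sum_(x : A) f (val x).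
  by move=> f1; rewrite -(big_seq_fsetE _ A xpredT f) (big_fsetD1 _ A1) /= f1 add0r.
have N0 : \sum_(h <- (A `\ 1%g)%fset) vec h *~ N h = 0.
  rewrite (drop1 _ (fun h => vec h *~ N h)); last by rewrite mul0rz.
  apply/rowP => k; rewrite summxE mxE; apply: (@intr_inj rat).
  rewrite rmorph_sum /=.
  transitivity (d%:~R * \sum_x v x * (p x k)%:~R); last by rewrite v2 mulr0.
  rewrite mulr_sumr; apply: eq_bigr => x _.
  rewrite mulrA -nE -!rmorphM /= -scaler_int mxE intz /N /p /scoord.
  by congr (_%:~R); ring.
have polar (h : G2 m) := meval_C_polar h ij.
have C1 : C_ (1%g : G2 m) = 0.
  have v10 k : vec (1%g : G2 m) 0 k = 0 by rewrite mxE.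
  rewrite /C_ !big1 => [|k _|k _]; last 2 first.
  - by rewrite v10 mulr0z.
  - by rewrite v10 mulr0z.
  by rewrite expr0n addr0 scaler0.
have := resA N N0; rewrite (drop1 _ (fun h => C_ h *~ N h)); last first.
  by rewrite C1 mul0rz.
move=> /(congr1 (fun q : {mpoly rat[m]} =>
   q.@[fun k : 'I_m => (k == i)%:R + (k == j)%:R]
   - q.@[fun k : 'I_m => (k == i)%:R] - q.@[fun k : 'I_m => (k == j)%:R])).
have mev (t : 'I_m -> rat) (f : A -> {mpoly rat[m]}) :
  (\sum_x f x).@[t] = \sum_x (f x).@[t] by rewrite raddf_sum.
rewrite !mev !meval0 !subr0 -!sumrB => E.
apply: (mulfI (_ : d%:~R != 0 :> rat)); first by rewrite intr_eq0.
rewrite mulr0 -[RHS]E mulr_sumr; apply: eq_bigr => x _.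
have mevz (t : 'I_m -> rat) (q : {mpoly rat[m]}) z : (q *~ z).@[t] = q.@[t] *~ z.
  by rewrite raddfMz.
rewrite !mevz -!mulrzBl polar !mulrA -nE -[X in _ = X]mulrzr /N /p /scoord !rmorphM /=.
by ring.
Qed.

End CombinatorialGraph.

(** The colours are read off from coordinate sums: [sgn g - sgn h = 2]. *)
Lemma comb_graph_double_difference (m : nat) (A : {fset G2 m}) :
  comb_graph A -> degenerate_resonant A ->
  exists g h i, [/\ g \in A, h \in A, sgn g = 1, sgn h = -1 &
    forall k, scoord h k - scoord g k = if k == i then 2 else 0].
Proof.
move=> Ac [Adeg Ares]; have A1 : 1%g \in A by case: Ac.
have [||||h [g [i hg]]] :=
  @exists_double_difference A 'I_m (fun x k => scoord (val x) k).
- by move=> x y xy; apply/val_inj/scoord_inj.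
- exact: comb_graph_cut_connected.
- exact: degenerate_relation.
- by move=> w; exact: resonant_diag.
exists (val g), (val h), i; rewrite !fsvalP.
have : \sum_k (scoord (val h) k - scoord (val g) k) = 2.
  by rewrite (eq_bigr _ (fun k _ => hg k)) -big_mkcond big_pred1_eq.
rewrite sumrB !sum_scoord; case: (sgn_cases (val g)) (sgn_cases (val h)) => -> [] ->.
all: by [] || lia.
Qed.

Lemma not_allowable_translate (m : nat) (A : {fset G2 m}) g h i :
  g \in A -> h \in A -> sgn g = 1 -> sgn h = -1 ->
  (forall k, scoord h k - scoord g k = if k == i then 2 else 0) ->
  ~ allowable (translate A g).
Proof.
move=> gA hA g1 h1 hg /(_ (h * g^-1)%g)[].
  by apply/imfsetP; exists h.
move=> ne _; apply: (ne i).
have vE : vec (h * g^-1)%g = vec h + sgn h *: - (sgn g *: vec g) by [].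
rewrite vE g1 h1 scale1r scaleN1r opprK.
apply/rowP => k; have := hg k.
rewrite /scoord g1 h1 mul1r mulN1r !mxE /= => E.
rewrite -mulr_natr natz; case: eqP E => _ /= E; lia.
Qed.

(** * The Euclidean scalar product *)

Section DotProduct.
Variables (R : realType) (n : nat).
Implicit Types u v w : 'rV[R]_n.

Lemma dotC u v : dot u v = dot v u.
Proof. by apply: eq_bigr => k _; rewrite mulrC. Qed.

Lemma dotDl u v w : dot (u + v) w = dot u w + dot v w.
Proof. by rewrite -big_split; apply: eq_bigr => k _; rewrite mxE mulrDl. Qed.

Lemma dotZl c u v : dot (c *: u) v = c * dot u v.
Proof. by rewrite mulr_sumr; apply: eq_bigr => k _; rewrite mxE mulrA. Qed.

Lemma dotNl u v : dot (- u) v = - dot u v.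
Proof. by rewrite -scaleN1r dotZl mulN1r. Qed.

Lemma dotDr u v w : dot w (u + v) = dot w u + dot w v.
Proof. by rewrite dotC dotDl !(dotC _ w). Qed.

Lemma dotNr u v : dot v (- u) = - dot v u.
Proof. by rewrite dotC dotNl dotC. Qed.

Lemma dotZr c u v : dot v (c *: u) = c * dot v u.
Proof. by rewrite dotC dotZl dotC. Qed.

Definition dotE := (dotDl, dotDr, dotNl, dotNr, dotZl, dotZr).

Lemma dot_eq0 u : dot u u = 0 -> u = 0.
Proof.
move=> /psumr_eq0P u0; apply/rowP => k; rewrite mxE; apply/eqP.
by rewrite -sqrf_eq0 expr2 u0 // => i _; rewrite -expr2 sqr_ge0.
Qed.

End DotProduct.

(** * Realizations and the points [x - pi(p(g))] *)

Section Realizations.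
Variables (R : realType) (m n : nat) (S : 'I_m -> 'rV[R]_n) (x : 'rV[R]_n).
Variable A : {fset G2 m}.
Hypothesis Sabc : forall a b c, a != b -> a != c -> b != c ->
  dot (S a - S b) (S a - S c) <> 0.
Hypothesis xA : realization S A x.

Definition rpoint (g : G2 m) := x - \sum_k (scoord g k)%:~R *: S k.
Definition rmass (g : G2 m) : R := \sum_k (scoord g k)%:~R * dot (S k) (S k).

(** Completing the square puts the black and the red equations into one formula. *)
Lemma rpoint_sqr g : g \in A ->
  dot (rpoint g) (rpoint g) = (sgn g)%:~R * (dot x x - rmass g).
Proof.
move=> gA; have [black red] := xA gA.
have pE : \sum_k (scoord g k)%:~R *: S k = (sgn g)%:~R *: pi_ S (vec g).
  rewrite /pi_ scaler_sumr; apply: eq_bigr => k _.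
  by rewrite -scaler_int scalerA -rmorphM.
have mE : rmass g = (sgn g)%:~R * \sum_i dot (S i) (S i) *~ vec g 0 i.
  rewrite mulr_sumr; apply: eq_bigr => k _.
  by rewrite -mulrzr /scoord rmorphM /=; ring.
rewrite /rpoint pE mE; move: black red; rewrite /K_; move: (pi_ S _) (\sum_i _) => u t.
case: (sgn_cases g) => ->.
  move=> /(_ erefl) E _; rewrite scale1r !dotE (dotC u x) E; lra.
move=> _ /(_ erefl) E; rewrite rmorphN1 scaleN1r opprK !dotE (dotC u x).
rewrite rmorphN1 in E; lra.
Qed.

Lemma rpoint_step g h (d : 'I_m -> int) :
  (forall k, scoord h k - scoord g k = d k) ->
  rpoint h = rpoint g - \sum_k (d k)%:~R *: S k /\
  rmass h = rmass g + \sum_k (d k)%:~R * dot (S k) (S k).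
Proof.
move=> gh; rewrite /rpoint /rmass; split.
  rewrite -addrA -opprD -big_split /=; congr (_ - _); apply: eq_bigr => k _.
  by rewrite -scalerDl -gh -rmorphD; congr (_%:~R *: _); ring.
rewrite -big_split /=; apply: eq_bigr => k _.
by rewrite -mulrDl -gh -rmorphD; congr (_%:~R * _); ring.
Qed.

Definition at_site g := exists i, rpoint g = (sgn g)%:~R *: S i.

Lemma sum_pick (V : lmodType R) (c : int) i (f : 'I_m -> V) :
  \sum_k (if k == i then c else 0)%:~R *: f k = c%:~R *: f i.
Proof.
rewrite (bigD1 i) //= eqxx big1 ?addr0 // => k /negPf ->; exact: scale0r.
Qed.

(** Adding the norm equations at [g] and [h] gives [2 |rpoint g - S i|^2 = 0]. *)
Lemma at_site_double g h i : g \in A -> h \in A -> sgn g = 1 -> sgn h = -1 ->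
  (forall k, scoord h k - scoord g k = if k == i then 2 else 0) -> at_site g.
Proof.
move=> gA hA g1 h1 gh; have [hp hm] := rpoint_step gh.
have := rpoint_sqr hA; have := rpoint_sqr gA; rewrite hp hm g1 h1.
rewrite sum_pick (sum_pick (V := R^o) _ _ (fun k => dot (S k) (S k))).
rewrite rmorphN1 => Eg Eh; exists i; rewrite g1 scale1r.
apply/eqP; rewrite -subr_eq0; apply/eqP/dot_eq0.
move: (rpoint g) Eg Eh => u Eg; rewrite !dotE (dotC (S i) u) Eg /GRing.scale /=.
lra.
Qed.

(** With [s = sgn l], the new point is [sgn g] times [S i - S j + s S k]. Its norm equation becomes
    [(S j - S i, S j - S k) = 0] for black [l] and [(S i - S j, S i - S k) = 0] for red [l], which
    [Sabc] forbids for distinct indices; when [i] is [j] or [k] the point is again a site. *)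
Lemma at_site_step g h : g \in A -> h \in A -> cayley g h -> at_site g -> at_site h.
Proof.
move=> gA hA lg' [i gi]; have [l lg hE] : exists2 l, l \in gens & h = (l * g)%g.
  by exists (h * g^-1)%g => //; rewrite -mulgA mulVg mulg1.
have sE : sgn h = sgn l * sgn g by rewrite hE.
have gh k : scoord h k - scoord g k = sgn g * scoord l k.
  by rewrite hE scoord_mul addrK.
have [hp hm] := rpoint_step gh.
move: lg; rewrite inE => /existsP[j /existsP[k /andP[jk lE]]].
have lc a : scoord l a = (if a == j then 1 else 0) + (if a == k then - sgn l else 0).
  rewrite /scoord /vec /sgn; case/orP: lE => /eqP -> /=; rewrite !mxE /=.
    by do 2!case: (a == _).
  by do 2!case: (a == _).
have lsum (V : lmodType R) (f : 'I_m -> V) :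
    \sum_a (sgn g * scoord l a)%:~R *: f a =
    (sgn g)%:~R *: (f j - (sgn l)%:~R *: f k).
  rewrite scalerBr scalerA -[X in X *: f j]mulr1.
  under eq_bigr do rewrite rmorphM -scalerA lc rmorphD scalerDl.
  rewrite -scaler_sumr big_split /= !sum_pick rmorph1 scale1r rmorphN scaleNr.
  by rewrite scalerBr scalerA mulr1.
have lsumR : \sum_a (sgn g * scoord l a)%:~R * dot (S a) (S a) =
    (sgn g)%:~R * (dot (S j) (S j) - (sgn l)%:~R * dot (S k) (S k)).
  exact: (lsum R^o (fun a => dot (S a) (S a))).
have := rpoint_sqr hA; have := rpoint_sqr gA; rewrite hp hm /at_site hp gi sE.
rewrite lsum lsumR -scalerBr !rmorphM /=.
have ss : (sgn g)%:~R * (sgn g)%:~R = 1 :> R by rewrite -rmorphM /= G2_sgnK.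
rewrite !dotZl !dotZr !mulrA ss !mul1r => Eg Eh.
have {Eh} : dot (S i - (S j - (sgn l)%:~R *: S k)) (S i - (S j - (sgn l)%:~R *: S k))
    = (sgn l)%:~R * dot (S i) (S i)
      - (sgn l)%:~R * (dot (S j) (S j) - (sgn l)%:~R * dot (S k) (S k)).
  rewrite Eh Eg; move: ((sgn g)%:~R) ((sgn l)%:~R) ss => a b aa.
  by ring: aa.
have jk_cases : i = j \/ i = k \/ [/\ i != j, i != k & j != k].
  by case: eqVneq => [|ij]; [left|right; case: eqVneq => [|ik]; [left|right]].
case: (sgn_cases l) => ->; rewrite ?rmorphN1 ?rmorph1 ?scale1r ?scaleN1r.
  rewrite !mul1r => E.
  have {}E : dot (S j - S i) (S j - S k) = 0.
    move: E; rewrite !dotE (dotC (S j) (S i)) (dotC (S k) (S i)) (dotC (S k) (S j)).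
    by lra.
  case: jk_cases => [ij|[ik|[ij ik _]]].
  - exists k; congr (_ *: _); rewrite ij opprB addrC subrK //.
  (* For [i = k] the equation reads [|S j - S i|^2 = 0]. *)
  - have ji : S j = S i.
      by apply/eqP; rewrite -subr_eq0; apply/eqP/dot_eq0; rewrite -ik in E.
    by exists i; rewrite -ik ji subrr subr0.
  - by case: (@Sabc j i k); rewrite // eq_sym.
rewrite !mulN1r !opprK => E.
have {}E : dot (S i - S j) (S i - S k) = 0.
  move: E; rewrite !dotE (dotC (S j) (S i)) (dotC (S k) (S i)) (dotC (S k) (S j)).
  by lra.
case: jk_cases => [ij|[ik|[ij ik _]]].
- by exists k; rewrite ij opprD addrA subrr sub0r scalerN scaleNr.
- by exists j; rewrite ik opprD addrC subrK scalerN scaleNr.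
- by case: (@Sabc i j k).
Qed.

End Realizations.

(** The site property holds at [g] by [at_site_double] and travels along a path of [A] to the
    identity, where [rpoint] is [x] itself. *)
Lemma no_realization (R : realType) (m n : nat) (A : {fset G2 m})
    (S : 'I_m -> 'rV[R]_n) (x : 'rV[R]_n) g h i :
  comb_graph A -> g \in A -> h \in A -> sgn g = 1 -> sgn h = -1 ->
  (forall k, scoord h k - scoord g k = if k == i then 2 else 0) ->
  (forall a b c, a != b -> a != c -> b != c ->
     dot (S a - S b) (S a - S c) <> 0) ->
  realization S A x -> exists i, x = S i.
Proof.
move=> [A1 Aconn] gA hA g1 h1 gh Sabc xA.
have site_g : at_site S x (val [` gA]%fset) := at_site_double xA gA hA g1 h1 gh.
have [s sp slast] := connectP (Aconn [` gA]%fset [` A1]%fset).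
have : at_site S x (val [` A1]%fset).
  rewrite slast; elim: s [` gA]%fset site_g sp {slast} => //= b s IH a site_a.
  move=> /andP[ab]; apply: IH.
  exact: (at_site_step Sabc xA (fsvalP a) (fsvalP b) ab site_a).
case=> j; rewrite /rpoint /= big1 => [|k _].
  by rewrite subr0 scale1r => ->; exists j.
by rewrite /scoord mxE mulr0 scale0r.
Qed.

Theorem mainTheorem2 (m : nat) (A : {fset G2 m}) (graphA : comb_graph A)
    (drA : degenerate_resonant A) :
  (exists2 g : G2 m, g \in A & ~ allowable (translate A g)) /\
  (forall (R : realType) (n : nat) (S : 'I_m -> 'rV[R]_n),
     (forall i j, dot (S i) (S j) <> 0) ->
     (forall a b c, a != b -> a != c -> b != c ->
        dot (S a - S b) (S a - S c) <> 0) ->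
     ~ exists2 x : 'rV[R]_n, (forall i, x <> S i) & realization S A x).
Proof.
have [g [h [i [gA hA g1 h1 gh]]]] := comb_graph_double_difference graphA drA.
split; first by exists g => //; apply: not_allowable_translate gA hA g1 h1 gh.
move=> R n S _ Sabc [x xS xA].
by have [j /xS] := no_realization graphA gA hA g1 h1 gh Sabc xA.
Qed.
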